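(* Let $m\geq1$, and let $\Gamma_m(s)=\sum_{j=0}^e\gamma_{m,j}s^j$ with $e=\lfloor m^2/4\rfloor$ be the gamma polynomial defined in the context. Every root of $\Gamma_m$ is a negative real number. If $e\geq2$, its coefficients satisfy $$\gamma_{m,j}^2\geq\frac{(j+1)(e-j+1)}{j(e-j)}\,\gamma_{m,j-1}\gamma_{m,j+1}\qquad(1\leq j<e).$$
   Context: Let $m\geq1$, $N=\left\lfloor\frac{(m+1)^2}{4}\right\rfloor$, $e=\left\lfloor\frac{m^2}{4}\right\rfloor$. For $0\leq j\leq e$ define $$\gamma_{m,j}=\sum_{(f,a,b,c)}\left(\prod_{1\leq p<r\leq m}(f_{pr}+1)\right)\left(\prod_{i=1}^m\frac{m!}{a_i!\,b_i!\,c_i!}\right),$$ where the (finite) sum is over all arrays of nonnegative integers $f=(f_{pr})_{1\leq p<r\leq m}$, $(a_i)_{i=1}^m$, $(b_i)_{i=1}^m$, $(c_i)_{i=1}^m$ such that for every $1\leq i\leq m$ $$a_i+b_i+c_i=m,\qquad 2a_i+b_i=2(m-i)+\sum_{r>i}f_{ir}-\sum_{p<i}f_{pi},$$ and $\sum_{i=1}^m c_i=N+j$. These are the coefficients of the gamma expansion $h_{m+2}^*(y)=y^N\sum_{j=0}^e\gamma_{m,j}y^j(1+y)^{2e-2j}$, where for $n=m+2$, $h_n^*(y)=(1-y)^{(n-1)^2+1}\sum_{t\geq0}h_n(t)y^t$ and $$h_n(t)=\mathrm{CT}_{x_2,\ldots,x_n}\frac{(1-x_n)\prod_{i=2}^{n-1}x_i^{n-1}\prod_{i=2}^{n-1}(x_i-x_n)}{x_n^t\prod_{i=2}^{n}(1-x_i)^3\prod_{2\leq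 i<j\leq n}(x_i-x_j)^2};$$ here the rational function is expanded in the iterated Laurent series field $\mathbb Q((x_2))\cdots((x_n))$ (Laurent series in $x_n$ with coefficients in $\mathbb Q((x_2))\cdots((x_{n-1}))$, recursively), and $\mathrm{CT}$ extracts the coefficient of $x_2^0\cdots x_n^0$. Assertions about roots of nonzero constants hold vacuously. *)

(* Defs.v *)
From mathcomp Require Import all_boot all_order all_algebra.
From mathcomp Require Import boolp classical_sets functions cardinality fsbigop.
From mathcomp Require Import reals complex.
From mathcomp Require Import zify.

Set Implicit Arguments.
Unset Strict Implicit.
Unset Printing Implicit Defensive.

Import Order.TTheory GRing.Theory Num.Theory.

Definition Nexp (m : nat) : nat := (m.+1 ^ 2) %/ 4.
Definition gexp (m : nat) : nat := (m ^ 2) %/ 4.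

(* Indices 1 <= i <= m are represented by i : 'I_m, of value i - 1. *)
Definition edge (m : nat) : finType := {pr : 'I_m * 'I_m | pr.1 < pr.2}.

(* Arrays ((f, a), b), c. *)
Definition arrays (m : nat) : choiceType :=
  ({ffun edge m -> nat} * {ffun 'I_m -> nat} *
   {ffun 'I_m -> nat} * {ffun 'I_m -> nat})%type.

Section Arrays.
Variables (m : nat) (x : arrays m).

Definition arr_f : {ffun edge m -> nat} := x.1.1.1.
Definition arr_a : {ffun 'I_m -> nat} := x.1.1.2.
Definition arr_b : {ffun 'I_m -> nat} := x.1.2.
Definition arr_c : {ffun 'I_m -> nat} := x.2.

Definition outflow (i : 'I_m) : nat := \sum_(u : edge m | (val u).1 == i) arr_f u.
Definition inflow (i : 'I_m) : nat := \sum_(u : edge m | (val u).2 == i) arr_f u.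

(* With i of value i' - 1 (1 <= i' <= m), m - i.+1 is m - i', never truncated. *)
Definition admissible (j : nat) : Prop :=
  [/\ forall i : 'I_m, arr_a i + arr_b i + arr_c i = m,
      forall i : 'I_m, ((2 * arr_a i + arr_b i)%:Z =
        (2 * (m - i.+1))%:Z + (outflow i)%:Z - (inflow i)%:Z)%R
    & \sum_(i < m) arr_c i = Nexp m + j].

(* On admissible arrays a_i + b_i + c_i = m, so the divisions are exact. *)
Definition weight : nat :=
  (\prod_(u : edge m) (arr_f u).+1) *
  (\prod_(i < m) (m`! %/ ((arr_a i)`! * (arr_b i)`! * (arr_c i)`!))).

End Arrays.

Local Open Scope classical_set_scope.

Lemma admissible_f_bound (m j : nat) (x : arrays m) (u : edge m) :
  admissible x j -> arr_f x u <= m * (2 * m * m).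
Proof.
case=> habc hflow _.
have hle i : outflow x i <= inflow x i + 2 * m.
  have := hflow i; have := habc i; lia.
have hsum : \sum_(i < m) outflow x i * (m - i) <=
    \sum_(i < m) inflow x i * (m - i) + m * (2 * m * m).
  rewrite -[X in _ + X * _]card_ord -sum_nat_const -big_split /=.
  by apply: leq_sum => i _; have := hle i; have := leq_subr i m; nia.
have E (g : edge m -> 'I_m) :
    \sum_(i < m) (\sum_(v : edge m | g v == i) arr_f x v) * (m - i) =
    \sum_(v : edge m) arr_f x v * (m - g v).
  rewrite [RHS](partition_big g xpredT) //=.
  apply: eq_bigr => i _; rewrite big_distrl /=.
  by apply: eq_bigr => v /eqP ->.
rewrite /outflow /inflow (E (fun v => (val v).1)) (E (fun v => (val v).2)) in hsum.
have hlow : \sum_(v : edge m) arr_f x v * (m - (val v).2) + \sum_(v : edge m) arr_f x v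
    <= \sum_(v : edge m) arr_f x v * (m - (val v).1).
  rewrite -big_split /=; apply: leq_sum => v _.
  have lt12 := valP v; have lt2 := ltn_ord (val v).2.
  rewrite -mulnSr leq_mul2l; apply/orP; right.
  move: lt12 lt2 => /=; lia.
have hu : arr_f x u <= \sum_(v : edge m) arr_f x v by rewrite (bigD1 u) //= leq_addr.
lia.
Qed.

(* The sum over admissible arrays below is thus a genuine finite sum, never the
   default value 0 that \sum_(x \in A) takes on an infinite support. *)
Lemma finite_admissible (m j : nat) : finite_set [set x : arrays m | admissible x j].
Proof.
pose B := m * (2 * m * m) + m.
pose T : finType := ({ffun edge m -> 'I_B.+1} * {ffun 'I_m -> 'I_B.+1} *
   {ffun 'I_m -> 'I_B.+1} * {ffun 'I_m -> 'I_B.+1})%type.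
pose F (y : T) : arrays m :=
  ([ffun u => val (y.1.1.1 u)], [ffun i => val (y.1.1.2 i)],
   [ffun i => val (y.1.2 i)], [ffun i => val (y.2 i)]).
apply: (@sub_finite_set _ _ (F @` [set: T])); last first.
  by apply: finite_image; exact: finite_finset.
move=> x hx; have hf u := admissible_f_bound u hx; case: hx => habc _ _.
exists ([ffun u => inord (arr_f x u)], [ffun i => inord (arr_a x i)],
        [ffun i => inord (arr_b x i)], [ffun i => inord (arr_c x i)]) => //.
case: x hf habc => [[[f a] b] c] hf habc; rewrite /F /=.
rewrite /arr_f /arr_a /arr_b /arr_c /= in hf habc *.
congr (_, _, _, _); apply/ffunP => i; rewrite !ffunE inordK // ltnS /B.
- exact: leq_trans (hf i) (leq_addr _ _).
- by have := habc i; lia.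
- by have := habc i; lia.
- by have := habc i; lia.
Qed.

Local Open Scope ring_scope.

Definition gamma (m j : nat) : nat :=
  \sum_(x \in [set x : arrays m | admissible x j]) weight x.

Definition Gamma (A : nzRingType) (m : nat) : {poly A} :=
  \poly_(j < (gexp m).+1) (gamma m j)%:R.

(* Main.v *)
Require Import Defs.
From mathcomp Require Import boolp classical_sets fsbigop.
From mathcomp Require Import all_boot all_order all_algebra.
From mathcomp Require Import reals complex.
From mathcomp Require Import zify ring lra.
From mathcomp Require Import perm mpoly.
Set Implicit Arguments.
Unset Strict Implicit.
Unset Printing Implicit Defensive.
Import Order.TTheory GRing.Theory Num.Theory.
Local Open Scope ring_scope.

(* Write (X^2 + X + s)^m as a product of 2m linear factors X + y_i. Then
   s^N Gamma_m(s) is the value at y of the flow form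
     G = sum_f (prod_u (f_u + 1)) (prod_i e_{a_i(f)}),
   with e_k the elementary symmetric polynomials and a_i(f) = 2i - out_i + in_i
   in terms of the flow f.

   G has no zero with all y_j in the upper half-plane H. Let S_s be the
   substitution e_k -> (1 - s^2 k^2) e_k followed by
   y^b -> prod_j (1 - s^2 b_j^2) y^b. For small s > 0 both maps preserve
   non-vanishing on H^2m, by the Gauss-Lucas argument on logarithmic derivatives.
   To second order S_s is 1 + s^2 L, where L raises flows: it is triangular, its
   top eigenvalue is simple, and prod_u (f_u + 1) is the corresponding left
   eigenvector. Hence G is the limit of the normalised iterates of S_s on
   prod_i e_{2i}, which does not vanish on H^2m, and Hurwitz's argument applies.

   If Gamma_m(z) = 0 and X^2 + X + z = (X + a)(X + b), then, G being homogeneous,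
   no rotation sends both a and b into H, so a/b is a negative real; as
   a + b = 1, z = ab < 0. Newton's inequalities follow from real-rootedness by
   differentiation and the inversion z -> -1/z, which reduce them to the
   discriminant of a quadratic. *)

(** * Zeros of polynomials and the upper half-plane *)

(** Summing [m! / (a! b! c!) s^c] over [2a + b = k] gives the coefficient of [X^k] in
    [(X^2 + X + s)^m], and the flow constraint reads [k = 2m - a_i(f)]; hence 2m variables and the
    indices [a_i(f)]. Neither half of S_s would do alone. On a product of the [e_(a_i)] the
    multiplier on monomials has second-order diagonal entry [2 * height] up to a constant, where the
    height sums f_u times the length of u: its iterates would favour large flows. The substitution
    on the e_k contributes [- sum_i (a_i - 2i)^2 - 4 * height] up to a constant, but it is diagonal
    and never leaves the initial product. Together they give [- sum_i (a_i - 2i)^2 - 2 * height]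
    after a shift, which is zero at the zero flow and negative elsewhere. Stability is preserved by
    S_s and not by 1 + s^2 L, so the iterates of S_s have to be compared with an Euler scheme for L
    under explicit error bounds. *)

Section HalfPlane.
Variable R : rcfType.
Local Notation C := R[i].
Local Notation Im := complex.Im.
Local Notation Re := complex.Re.
Implicit Types (x y z u v : C) (f p : {poly C}).

Lemma ImD x y : Im (x + y) = Im x + Im y. Proof. by case: x; case: y. Qed.
Lemma ImN x : Im (- x) = - Im x. Proof. by case: x. Qed.
Lemma Im_sum (I : Type) (r : seq I) (P : pred I) (F : I -> C) :
  Im (\sum_(i <- r | P i) F i) = \sum_(i <- r | P i) Im (F i).
Proof. by elim/big_ind2: _ => // a x b y <- <-; rewrite ImD. Qed.
Lemma ImZ (a : R) x : Im (a%:C%C * x) = a * Im x.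
Proof. by case: x => b c /=; rewrite mul0r addr0. Qed.

Lemma ImV_sign x : exists2 a : R, 0 <= a & Im x^-1 = - (a * Im x) /\ (x != 0 -> 0 < a).
Proof.
case: x => a b; exists ((a ^+ 2 + b ^+ 2)^-1).
  by rewrite invr_ge0 addr_ge0 // sqr_ge0.
split=> [|nz]; first by rewrite /= mulrC.
rewrite invr_gt0 lt0r addr_ge0 ?sqr_ge0 // andbT.
apply: contra nz; rewrite paddr_eq0 ?sqr_ge0 // !expf_eq0 /=.
by rewrite eq_complex /=.
Qed.

Lemma ImV_lt0 x : 0 < Im x -> Im x^-1 < 0.
Proof.
move=> hx; have nz : x != 0 by apply: contraTneq hx => -> /=; rewrite ltxx.
have [a _ [-> /(_ nz) a0]] := ImV_sign x.
by rewrite oppr_lt0 mulr_gt0.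
Qed.

Lemma ImV_le0 x : 0 <= Im x -> Im x^-1 <= 0.
Proof. by move=> hx; have [a a0 [-> _]] := ImV_sign x; rewrite oppr_le0 mulr_ge0. Qed.

Lemma poly_roots f : f != 0 ->
  exists2 r : seq C, f = lead_coef f *: \prod_(z <- r) ('X - z%:P) & size f = (size r).+1.
Proof.
move=> f0; have [r fE] := closed_field_poly_normal f; exists r => //.
by rewrite fE size_scale ?lead_coef_eq0 // size_prod_XsubC.
Qed.

Lemma horner_rootprod (r : seq C) z :
  (\prod_(u <- r) ('X - u%:P)).[z] = \prod_(u <- r) (z - u).
Proof. by rewrite horner_prod; apply: eq_bigr => u _; rewrite hornerXsubC. Qed.

Lemma deriv_rootprod (r : seq C) z : {in r, forall u, u != z} ->
  (\prod_(u <- r) ('X - u%:P))^`().[z] =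
    \prod_(u <- r) (z - u) * \sum_(u <- r) (z - u)^-1.
Proof.
elim: r => [|u r IH] hr; first by rewrite !big_nil derivE horner0 mulr0.
rewrite !big_cons derivM hornerD !hornerM IH; last first.
  by move=> v hv; apply: hr; rewrite inE hv orbT.
rewrite derivXsubC hornerXsubC horner_rootprod hornerC.
have zu : z - u != 0 by rewrite subr_eq0 eq_sym hr // mem_head.
by rewrite mulrDr mul1r mulrAC divff // mul1r -mulrA.
Qed.

Lemma logderiv_roots f z : f.[z] != 0 ->
  exists2 r : seq C, [/\ size f = (size r).+1, {in r, forall u, root f u}
      & {in r, forall u, u != z}] &
    f^`().[z] = f.[z] * \sum_(u <- r) (z - u)^-1.
Proof.
move=> fz; have f0 : f != 0 by apply: contraNneq fz => ->; rewrite horner0.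
have [r fE sz] := poly_roots f0; exists r.
  have rr : {in r, forall u, root f u}.
    move=> u ur; rewrite fE rootZ ?lead_coef_eq0 //.
    by rewrite root_prod_XsubC.
  by split=> // u /rr ru; apply: contraNneq fz => <-.
rewrite {1}fE derivZ hornerZ deriv_rootprod; last first.
  move=> u ur; apply: contraNneq fz => <-.
  by rewrite fE hornerZ horner_rootprod (big_rem u) //= subrr mul0r mulr0.
by rewrite {2}fE hornerZ horner_rootprod mulrA.
Qed.

Lemma Im_sum_inv (r : seq C) z : {in r, forall u, Im u < Im z} -> r != [::] ->
  Im (\sum_(u <- r) (z - u)^-1) < 0.
Proof.
move=> hr r0; rewrite Im_sum.
have h u : u \in r -> Im (z - u)^-1 < 0.
  by move=> /hr ur; rewrite ImV_lt0 // ImD ImN subr_gt0.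
case: r r0 hr h => // u r _ _ h; rewrite big_cons.
rewrite -[ltRHS]addr0 ltr_leD ?h ?mem_head // big_seq.
by apply: sumr_le0 => v vr; rewrite ltW // h // inE vr orbT.
Qed.

(** With every root u strictly below z, each [1/(z - u)] has negative imaginary part, so the
    logarithmic derivative cannot vanish at z. The size hypothesis provides at least one root. *)
Lemma gauss_lucas f z : (1 < size f)%N ->
  (forall u, Im z <= Im u -> f.[u] != 0) -> f^`().[z] != 0.
Proof.
move=> sf hf; have fz := hf z (lexx _).
have [r [sz rr rz] ->] := logderiv_roots fz.
rewrite mulf_neq0 //; apply/eqP => s0.
have : Im (\sum_(u <- r) (z - u)^-1) < 0.
  apply: Im_sum_inv => [u /rr|].
    by rewrite ltNge; apply: contraL => /hf; rewrite /root => /negbTE->.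
  by apply: contraTneq sf => r0; rewrite sz r0.
by rewrite s0 ltxx.
Qed.

(** With S the sum of the [1/(z - u)] over the roots, a zero would force [c S = - 1/z]; but
    [Im S < 0], while [- 1/z] has non-negative imaginary part. Real z are included for the sake of
    [esum_scaled]. *)
Lemma theta_pos (c : R) f z : 0 < c -> 0 <= Im z ->
  (forall u, Im z <= Im u -> f.[u] != 0) -> f.[z] + c%:C%C * (z * f^`().[z]) != 0.
Proof.
move=> c0 hz hf; have fz := hf z (lexx _).
have [z00|z0] := eqVneq z 0; first by rewrite {2}z00 mul0r mulr0 addr0.
have [r [sz rr rz] ->] := logderiv_roots fz.
have [r0|r0] := eqVneq r [::].
  by rewrite r0 big_nil !mulr0 addr0.
set S := \sum_(u <- r) _.
have -> : f.[z] + c%:C%C * (z * (f.[z] * S)) = f.[z] * (1 + c%:C%C * z * S) by ring.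
rewrite mulf_neq0 //; apply/eqP => e.
have hS : Im S < 0.
  apply: Im_sum_inv => // u /rr.
  by rewrite ltNge; apply: contraL => /hf; rewrite /root => /negbTE->.
have : Im (c%:C%C * S) = - Im z^-1.
  rewrite -ImN; congr (Im _); apply: (mulfI z0); rewrite mulrN divff //.
  by apply: (addrI 1); rewrite subrr -[RHS]e; ring.
have := ImV_le0 hz; have : c * Im S < 0 by rewrite pmulr_rlt0.
rewrite ImZ; lra.
Qed.

(** A zero would give [z S = 1/c]. Splitting off the number of roots, which [c * d < 1] keeps below
    [1/c], leaves a sum of terms [z u / (z - u)] equal to a positive multiple of z, whereas each
    nonzero term lies in the open lower half-plane. *)
Lemma theta_neg (c : R) f z d : (size f <= d.+1)%N -> 0 < c -> c * d%:R < 1 ->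
  0 <= Im z -> (forall u, 0 < Im u -> f.[u] != 0) ->
  (forall u, Im z <= Im u -> f.[u] != 0) -> f.[z] - c%:C%C * (z * f^`().[z]) != 0.
Proof.
move=> sf c0 cd hz hf0 hf; have fz := hf z (lexx _).
have [z00|z0] := eqVneq z 0; first by rewrite {2}z00 mul0r mulr0 subr0.
have [r [sz rr rz] ->] := logderiv_roots fz.
set S := \sum_(u <- r) _.
have -> : f.[z] - c%:C%C * (z * (f.[z] * S)) = f.[z] * (1 - c%:C%C * (z * S)) by ring.
rewrite mulf_neq0 //; apply/eqP => e.
pose T := \sum_(u <- r) (z * u / (z - u)).
have zS : z * S = (size r)%:R + z^-1 * T.
  rewrite /S /T !mulr_sumr -sum1_size natr_sum -big_split /= !big_seq.
  apply: eq_bigr => u ur; have zu : z - u != 0 by rewrite subr_eq0 eq_sym rz.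
  by field; rewrite zu z0.
have cC : c%:C%C != 0 :> C by rewrite eq_complex /= gt_eqF.
have TE : T = (c^-1 - (size r)%:R)%:C%C * z.
  have : z * S = (c^-1)%:C%C.
    apply: (mulfI cC); rewrite -rmorphM /= divff ?gt_eqF // rmorph1.
    by apply/eqP; rewrite eq_sym -subr_eq0 e.
  rewrite zS => h.
  have : z^-1 * T = (c^-1 - (size r)%:R)%:C%C.
    by rewrite rmorphB /= rmorph_nat -h addrAC subrr add0r.
  by move=> <-; rewrite mulrC mulrA divff ?mul1r.
have hk : 0 < c^-1 - (size r)%:R.
  rewrite subr_gt0 -(ltr_pM2l c0) divff ?gt_eqF //.
  apply: le_lt_trans cd; rewrite ler_pM2l // ler_nat -ltnS -sz //.
have hu u : u \in r -> [/\ Im u <= 0, Im u < Im z & u != z].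
  move=> ur; have /rr /eqP fu := ur; split; last exact: rz.
  - by rewrite leNgt; apply/negP => /hf0; rewrite fu eqxx.
  - by rewrite ltNge; apply/negP => /hf; rewrite fu eqxx.
have term u : u \in r -> Im (z * u / (z - u)) <= 0 /\ (u != 0 -> Im (z * u / (z - u)) < 0).
  move=> /hu [u0 uz ne]; have [->|nu] := eqVneq u 0; first by rewrite mulr0 mul0r.
  have zu : z - u != 0 by rewrite subr_eq0 eq_sym.
  suff h : Im (z * u / (z - u)) < 0 by split=> //; apply: ltW.
  (* [Im u^-1] and [- Im z^-1] are both non-negative; the second is positive if z is not real, and
     otherwise the first is, since u then lies strictly below the real axis. *)
  have -> : z * u / (z - u) = (u^-1 - z^-1)^-1.
    have -> : u^-1 - z^-1 = (z - u) / (z * u) by field; rewrite nu z0.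
    by rewrite invf_div.
  apply: ImV_lt0; rewrite ImD ImN.
  have [a a0 [-> /(_ nu) a1]] := ImV_sign u; have [b b0 [-> /(_ z0) b1]] := ImV_sign z.
  rewrite opprK; have [zn|zn] := eqVneq (Im z) 0.
    by rewrite zn mulr0 addr0 oppr_gt0 pmulr_rlt0 // -zn.
  have : 0 < b * Im z by rewrite mulr_gt0 // lt0r zn hz.
  have : a * Im u <= 0 by rewrite pmulr_rle0.
  lra.
have [ur0|[u ur un]] : {in r, forall u, u = 0} \/ exists2 u, u \in r & u != 0.
  case: (boolP (has (fun u => u != 0) r)) => [/hasP|/hasPn h]; [by right|left].
  by move=> u /h /negPn /eqP.
  move: TE; rewrite /T big_seq big1 => [/esym/eqP|u /ur0 ->]; last by rewrite mulr0 mul0r.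
  by rewrite mulf_eq0 (negbTE z0) orbF eq_complex /= gt_eqF.
have : Im T < 0.
  rewrite /T (big_rem u) //= ImD -[ltRHS]addr0 ltr_leD ?(term u ur).2 // Im_sum big_seq.
  by apply: sumr_le0 => v vr; apply: (term v _).1; apply: mem_rem vr.
rewrite TE ImZ ltNge mulr_ge0 // ltW //.
Qed.

(** Every root u is at distance at least r from z, so [|w - u| <= (1 + |w - z| / r) |z - u|] factor
    by factor. The constant depends on f only through the degree bound, which lets it survive a
    limit. *)
Lemma norm_horner_le f z w d (r : R) : (size f <= d.+1)%N -> 0 < r ->
  (forall u, `|z - u| < r%:C%C -> f.[u] != 0) ->
  `|f.[w]| <= (1 + `|w - z| / r%:C%C) ^+ d * `|f.[z]|.
Proof.
move=> sf r0 hf; have rC : 0 < r%:C%C :> C by rewrite ltcR.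
have [->|f0] := eqVneq f 0; first by rewrite !horner0 !normr0 mulr0.
have [s fE sz] := poly_roots f0.
have B1 : 1 <= 1 + `|w - z| / r%:C%C.
  by rewrite lerDl divr_ge0 // ltW.
set B := 1 + _ in B1 *; have B0 : 0 <= B by apply: le_trans B1.
suff h : {in s, forall u, root f u} ->
    `|\prod_(u <- s) (w - u)| <= B ^+ size s * `|\prod_(u <- s) (z - u)|.
  rewrite fE !hornerZ !horner_rootprod !normrM mulrCA ler_wpM2l //.
  apply: le_trans (h _) _.
    by move=> u us; rewrite fE rootZ ?lead_coef_eq0 // root_prod_XsubC.
  rewrite ler_wpM2r // ler_weXn2l //; move: sf; rewrite sz ltnS //.
elim: s {fE sz} => [|u s IH] hs; first by rewrite !big_nil expr0 mul1r.
rewrite !big_cons !normrM exprS mulrACA ler_pM //; last first.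
  by apply: IH => v vs; apply: hs; rewrite inE vs orbT.
have hu : r%:C%C <= `|z - u|.
  rewrite real_leNgt ?realE ?normr_ge0 // ?(ltW rC) //.
  by apply/negP => /hf; rewrite (eqP (hs u (mem_head _ _))) eqxx.
have -> : w - u = (w - z) + (z - u) by rewrite addrA subrK.
apply: le_trans (ler_normD _ _) _; rewrite /B mulrDl mul1r addrC lerD2l.
by rewrite -mulrA ler_peMr // ler_pdivlMl // mulr1.
Qed.
End HalfPlane.

(** * Limits of perturbed Euler schemes *)

Lemma steps_split (p t q : nat) : (q * (p * t) ^ 2 = (p * t ^ 2) * (p * q))%N.
Proof. by rewrite !expnS !expn0; ring. Qed.

Section Trotter.
Variable R : archiRealFieldType.

Definition norm1 (T : finType) (v : T -> R) : R := \sum_t `|v t|.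

Lemma norm1_ge0 (T : finType) (v : T -> R) : 0 <= norm1 v.
Proof. by apply: sumr_ge0. Qed.

Lemma le_norm1 (T : finType) (v : T -> R) t : `|v t| <= norm1 v.
Proof. by rewrite /norm1 (bigD1 t) //= lerDl sumr_ge0. Qed.

Lemma norm1D (T : finType) (u v : T -> R) :
  norm1 (fun t => u t + v t) <= norm1 u + norm1 v.
Proof. by rewrite /norm1 -big_split /=; apply: ler_sum => t _; apply: ler_normD. Qed.

Lemma norm1_eq (T : finType) (u v : T -> R) : u =1 v -> norm1 u = norm1 v.
Proof. by move=> e; apply: eq_bigr => t _; rewrite e. Qed.

Lemma sum_delta (T : finType) (v : T -> R) t : \sum_i v i * (i == t)%:R = v t.
Proof.
rewrite (bigD1 t) //= eqxx mulr1 big1 ?addr0 // => i /negbTE it.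
by rewrite it mulr0.
Qed.

Definition matnorm (S T : finType) (A : S -> T -> R) : R := \sum_i \sum_j `|A i j|.

Lemma matnorm_ge0 (S T : finType) (A : S -> T -> R) : 0 <= matnorm A.
Proof. by apply: sumr_ge0 => i _; apply: sumr_ge0. Qed.

Definition act (S T : finType) (A : S -> T -> R) (x : S -> R) (t : T) : R :=
  \sum_i x i * A i t.

Lemma norm1_act (S T : finType) (A : S -> T -> R) (x : S -> R) :
  norm1 (act A x) <= matnorm A * norm1 x.
Proof.
apply: le_trans (_ : \sum_t \sum_i `|x i| * `|A i t| <= _).
  apply: ler_sum => t _; apply: le_trans (ler_norm_sum _ _ _) _.
  by apply: ler_sum => i _; rewrite normrM.
rewrite exchange_big mulr_sumr; apply: ler_sum => i _.
rewrite -mulr_sumr mulrC ler_wpM2r // /matnorm (bigD1 i) //= lerDl.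
by apply: sumr_ge0 => k _; apply: sumr_ge0.
Qed.

Definition cnorm (p : {poly R}) : R := \sum_(i < size p) `|p`_i|.

Lemma horner_trunc (p : {poly R}) (k : nat) (s : R) : 0 <= s <= 1 ->
  `|p.[s] - \sum_(i < k) p`_i * s ^+ i| <= cnorm p * s ^+ k.
Proof.
move=> /andP[s0 s1]; set d := maxn (size p) k.
have kd : (k <= d)%N by rewrite leq_maxr.
have pd : (size p <= d)%N by rewrite leq_maxl.
rewrite (horner_coef_wide _ pd) -(big_mkord xpredT (fun i => p`_i * s ^+ i)).
rewrite -[X in _ - X](big_mkord xpredT (fun i => p`_i * s ^+ i)).
rewrite (@big_cat_nat _ _ _ k) //= addrAC subrr add0r.
apply: le_trans (ler_norm_sum _ _ _) _.
have -> : cnorm p = \sum_(0 <= i < d) `|p`_i|.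
  rewrite /cnorm -(big_mkord xpredT (fun i => `|p`_i|)) [RHS](@big_cat_nat _ _ _ (size p)) //=.
  rewrite [X in _ + X]big1_seq ?addr0 // => i /=; rewrite mem_index_iota => /andP[hi _].
  by rewrite nth_default // normr0.
rewrite [X in _ <= X * _](@big_cat_nat _ _ _ k) //= mulrDl.
rewrite -[leLHS]add0r lerD ?mulr_ge0 ?exprn_ge0 ?sumr_ge0 // mulr_suml.
rewrite !big_nat; apply: ler_sum => i /andP[ki _].
rewrite normrM ler_wpM2l // normrX ger0_norm // ler_wiXn2l // s0 s1.
Qed.

Lemma bernoulli_up (x : R) n : 0 <= x -> n%:R * x <= 1 / 2 -> (1 + x) ^+ n <= 2.
Proof.
move=> x0 hn.
have h k : (1 + x) ^+ k * (1 - k%:R * x) <= 1.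
  elim: k => [|k IH]; first by rewrite expr0 mul0r subr0 mulr1.
  apply: le_trans IH; rewrite exprSr -mulrA ler_wpM2l ?exprn_ge0 ?addr_ge0 //.
  have : 0 <= (k.+1)%:R * x ^+ 2 :> R by rewrite mulr_ge0 ?sqr_ge0.
  rewrite -[k.+1]addn1 natrD; nra.
have p0 : 0 <= (1 + x) ^+ n by rewrite exprn_ge0 // addr_ge0.
have := h n; nra.
Qed.

Lemma bernoulli_down (y : R) n : 0 <= y <= 1 -> (1 - y) ^+ n * (1 + n%:R * y) <= 1.
Proof.
move=> /andP[y0 y1]; elim: n => [|k IH]; first by rewrite expr0 mul0r addr0 mulr1.
apply: le_trans IH; rewrite exprSr -mulrA ler_wpM2l ?exprn_ge0 ?subr_ge0 //.
have : 0 <= (k.+1)%:R * y ^+ 2 :> R by rewrite mulr_ge0 ?sqr_ge0.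
rewrite -[k.+1]addn1 natrD; nra.
Qed.

(** In the application I indexes monomials in the elementary symmetric polynomials, J indexes flows,
    and row j of [P] lists the coefficients of the product attached to j. [Mat2] says that [P]
    intertwines the second-order part of [Mat] with [L]. Vectors are rows, so the limit [g] is a
    left null vector. *)
Variables (I J : finType) (Mat : I -> I -> {poly R}) (P : J -> I -> R).
Variables (L : J -> J -> R) (h : J -> nat) (j0 : J) (g : J -> R).
Hypothesis Mat0 : forall a b, (Mat a b)`_0 = (a == b)%:R.
Hypothesis Mat1 : forall a b, (Mat a b)`_1 = 0.
Hypothesis Mat2 : forall j b,
  \sum_a P j a * (Mat a b)`_2 = \sum_k L j k * P k b.
Hypothesis L_diag : forall j, j != j0 -> L j j <= -1.
Hypothesis L_up : forall j k, L j k != 0 -> j != k -> (h j < h k)%N.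
Hypothesis h_j0 : h j0 = 0%N.
Hypothesis g_j0 : g j0 = 1.
Hypothesis g_ker : forall k, \sum_j g j * L j k = 0.

Definition step (s : R) (v : I -> R) : I -> R := act (fun a b => (Mat a b).[s]) v.
Definition euler (s : R) (x : J -> R) (k : J) : R := x k + s ^+ 2 * act L x k.

Let A := \sum_a \sum_b cnorm (Mat a b).

Let cnorm_ge0 (p : {poly R}) : 0 <= cnorm p. Proof. exact: sumr_ge0. Qed.
Let A_ge0 : 0 <= A. Proof. by apply: sumr_ge0 => a _; apply: sumr_ge0. Qed.

Let sum_err (v : I -> R) (E : I -> I -> R) (c : R) : 0 <= c ->
  (forall a b, `|E a b| <= cnorm (Mat a b) * c) -> norm1 (act E v) <= A * c * norm1 v.
Proof.
move=> c0 hE; apply: le_trans (norm1_act _ _) _.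
rewrite ler_wpM2r ?norm1_ge0 // /matnorm /A mulr_suml; apply: ler_sum => a _.
by rewrite mulr_suml; apply: ler_sum.
Qed.

Let step_bound (s : R) (v : I -> R) : 0 <= s <= 1 ->
  norm1 (step s v) <= (1 + A * s ^+ 2) * norm1 v.
Proof.
move=> hs; pose E a b := (Mat a b).[s] - (a == b)%:R.
have -> : norm1 (step s v) = norm1 (fun b => v b + act E v b).
  apply: norm1_eq => b; rewrite /step /act /E; under [in RHS]eq_bigr do rewrite mulrBr.
  by rewrite sumrB sum_delta addrC subrK.
apply: le_trans (norm1D _ _) _; rewrite mulrDl mul1r lerD2l.
apply: sum_err; first exact: sqr_ge0.
move=> a b; have := horner_trunc (Mat a b) 2 hs.
by rewrite !big_ord_recl big_ord0 /= Mat0 Mat1 mul0r !addr0 mulr1.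
Qed.

Let step_euler (s : R) (x : J -> R) : 0 <= s <= 1 ->
  norm1 (fun b => step s (act P x) b - act P (euler s x) b)
    <= A * s ^+ 3 * (matnorm P * norm1 x).
Proof.
move=> hs; pose E a b := (Mat a b).[s] - ((a == b)%:R + (Mat a b)`_2 * s ^+ 2).
have -> : norm1 (fun b => step s (act P x) b - act P (euler s x) b) =
          norm1 (act E (act P x)).
  apply: norm1_eq => b; rewrite [RHS]/act /E.
  under [in RHS]eq_bigr do rewrite mulrBr mulrDr.
  rewrite sumrB big_split /=; congr (_ - _).
  rewrite sum_delta /euler {1}/act /=; under eq_bigr do rewrite mulrDl.
  rewrite big_split /=; congr (_ + _).
  rewrite [RHS](eq_bigr (fun a => s ^+ 2 * (\sum_j x j * (P j a * (Mat a b)`_2)))); last first.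
    by move=> a _; rewrite /act mulrA [RHS]mulrC mulr_suml; congr (_ * _);
       apply: eq_bigr => j _; rewrite mulrA.
  rewrite -mulr_sumr exchange_big /=.
  under [in RHS]eq_bigr do rewrite -mulr_sumr Mat2 mulr_sumr.
  rewrite [in RHS]exchange_big /= mulr_sumr; apply: eq_bigr => k _.
  rewrite /act -mulrA; congr (_ * _); rewrite mulr_suml.
  by apply: eq_bigr => j _; rewrite mulrA.
apply: le_trans (_ : A * s ^+ 3 * norm1 (act P x) <= _).
  have s3 : 0 <= s ^+ 3 by rewrite exprn_ge0 //; case/andP: hs.
  apply: sum_err => // a b; have := horner_trunc (Mat a b) 3 hs.
  by rewrite !big_ord_recl big_ord0 /= Mat0 Mat1 mul0r !addr0 add0r mulr1.
rewrite ler_wpM2l ?norm1_act // mulr_ge0 // exprn_ge0 //; by case/andP: hs.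
Qed.

(* [L] is triangular for [h] with diagonal at most -1 away from [j0]; weighting
   level [h j] by [eta ^+ h j] makes its off-diagonal part at most 1/2, so one
   Euler step contracts by [1 - s^2 / 2]. *)
Let eta : R := (2 * (matnorm L + 1))^-1.
Let W (x : J -> R) : R := \sum_j eta ^+ h j * `|x j|.

Let L_ge0 : 0 <= matnorm L. Proof. exact: matnorm_ge0. Qed.
Let eta_gt0 : 0 < eta.
Proof. by rewrite /eta invr_gt0 mulr_gt0 // ltr_wpDl. Qed.
Let eta_le1 : eta <= 1.
Proof. by rewrite /eta invf_le1 ?mulr_gt0 // ?ltr_wpDl //; have := L_ge0; lra. Qed.
Let eta_L : eta * matnorm L <= 1 / 2.
Proof.
rewrite /eta mulrC ler_pdivrMr ?mulr_gt0 // ?ltr_wpDl //.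
by have := L_ge0; lra.
Qed.

Let row_le j : \sum_k `|L j k| <= matnorm L.
Proof.
rewrite /matnorm [leRHS](bigD1 j) //= lerDl.
by apply: sumr_ge0 => i _; apply: sumr_ge0.
Qed.

Let euler_j0 s x : x j0 = 0 -> euler s x j0 = 0.
Proof.
move=> x0; rewrite /euler x0 add0r /act big1 ?mulr0 // => j _.
have [->|jj] := eqVneq j j0; first by rewrite x0 mul0r.
have [->|Lj] := eqVneq (L j j0) 0; first by rewrite mulr0.
by have := L_up Lj jj; rewrite h_j0.
Qed.

Let contract s x : 0 <= s -> s ^+ 2 * (matnorm L + 1) <= 1 -> x j0 = 0 ->
  W (euler s x) <= (1 - s ^+ 2 / 2) * W x.
Proof.
move=> s0 hs x0; have s2 : 0 <= s ^+ 2 by exact: sqr_ge0.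
apply: le_trans
  (_ : \sum_j `|x j| * \sum_k eta ^+ h k * `|(j == k)%:R + s ^+ 2 * L j k| <= _).
  under [leRHS]eq_bigr do rewrite mulr_sumr.
  rewrite [leRHS]exchange_big /=; apply: ler_sum => k _.
  have -> : euler s x k = \sum_j x j * ((j == k)%:R + s ^+ 2 * L j k).
    under eq_bigr do rewrite mulrDr.
    rewrite big_split /= sum_delta /euler /act mulr_sumr; congr (_ + _).
    by apply: eq_bigr => j _; rewrite mulrCA.
  have ek : 0 <= eta ^+ h k by rewrite exprn_ge0 // ltW.
  apply: le_trans (ler_wpM2l ek (ler_norm_sum _ _ _)) _.
  by rewrite mulr_sumr; apply: ler_sum => j _; rewrite normrM mulrCA.
rewrite /W mulr_sumr; apply: ler_sum => j _.
have [->|jj] := eqVneq j j0; first by rewrite x0 normr0 mul0r !mulr0.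
rewrite [leRHS]mulrA [leRHS]mulrC ler_wpM2l // (bigD1 j) //= eqxx.
have Lj := L_diag jj.
have Ljn : `|L j j| <= matnorm L.
  by apply: le_trans (row_le j); rewrite (bigD1 j) //= lerDl sumr_ge0.
have ej : 0 <= eta ^+ h j by rewrite exprn_ge0 // ltW.
have off : \sum_(k | k != j) eta ^+ h k * `|(j == k)%:R + s ^+ 2 * L j k|
    <= s ^+ 2 / 2 * eta ^+ h j.
  apply: le_trans (_ : \sum_(k | k != j) eta ^+ h j * (s ^+ 2 * eta * `|L j k|) <= _).
    apply: ler_sum => k kj; rewrite eq_sym (negbTE kj) add0r normrM ger0_norm //.
    have [->|Lk] := eqVneq (L j k) 0; first by rewrite normr0 !mulr0.
    rewrite eq_sym in kj; have := L_up Lk kj => hjk.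
    rewrite [leRHS](_ : _ = eta ^+ (h j).+1 * (s ^+ 2 * `|L j k|)); last first.
      by rewrite [eta ^+ _.+1]exprS; set z := eta ^+ h j; ring.
    by rewrite ler_wpM2r ?mulr_ge0 // ler_wiXn2l // ltW.
  rewrite -mulr_sumr -mulr_sumr mulrC ler_wpM2r // -mulrA ler_wpM2l //.
  apply: (@le_trans _ _ (eta * matnorm L)); last by rewrite -[leRHS]mul1r.
  rewrite (ler_wpM2l (ltW eta_gt0)) //; apply: le_trans (row_le j).
  by rewrite [leRHS](bigD1 j) //= lerDr.
have diag : `|1 + s ^+ 2 * L j j| <= 1 - s ^+ 2.
  have h1 : s ^+ 2 * L j j <= - s ^+ 2 by rewrite -mulrN1 ler_wpM2l.
  have h2 : - 1 <= s ^+ 2 * L j j.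
    have /andP[Ll _] : - matnorm L <= L j j <= matnorm L by rewrite -ler_norml.
    have : s ^+ 2 * - matnorm L <= s ^+ 2 * L j j by rewrite ler_wpM2l.
    by move: hs s2; rewrite mulrN; lra.
  rewrite ger0_norm; lra.
have : eta ^+ h j * `|1 + s ^+ 2 * L j j| <= eta ^+ h j * (1 - s ^+ 2).
  by rewrite ler_wpM2l.
move: off; lra.
Qed.

Let H := (\max_j h j)%N.
Let W_norm x : eta ^+ H * norm1 x <= W x.
Proof.
rewrite /norm1 mulr_sumr; apply: ler_sum => j _; rewrite ler_wpM2r //.
by apply: (ler_wiXn2l (ltW eta_gt0) eta_le1); exact: leq_bigmax.
Qed.
Let W_le x : W x <= norm1 x.
Proof.
by apply: ler_sum => j _; rewrite ler_piMl // exprn_ile1 // ltW.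
Qed.

(** Every Euler step fixes [g], so the deviation from [g] obeys the same recursion. By [g_j0] it
    starts at zero in the coordinate [j0], by [euler_j0] it stays there, and [contract] applies. *)
Let r0 (j : J) : R := (j == j0)%:R - g j.
Let r_ k s := iter k (euler s) r0.
Let r0_j0 : r0 j0 = 0. Proof. by rewrite /r0 eqxx g_j0 subrr. Qed.

Let K : R := (eta ^+ H)^-1 * norm1 r0.
Let K_ge0 : 0 <= K.
Proof. by rewrite mulr_ge0 ?norm1_ge0 // invr_ge0 exprn_ge0 // ltW. Qed.

Let r_bound k s : 0 <= s -> s ^+ 2 * (matnorm L + 1) <= 1 ->
  norm1 (r_ k s) <= K * (1 - s ^+ 2 / 2) ^+ k.
Proof.
move=> s0 hs; have s2 : 0 <= s ^+ 2 by exact: sqr_ge0.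
have q0 : 0 <= 1 - s ^+ 2 / 2 by have := L_ge0; nra.
have [_ hW] : r_ k s j0 = 0 /\ W (r_ k s) <= (1 - s ^+ 2 / 2) ^+ k * norm1 r0.
  elim: k => [|k [IH1 IH2]]; first by rewrite expr0 mul1r.
  split; first by rewrite /r_ iterS euler_j0.
  rewrite /r_ iterS exprS -mulrA; apply: le_trans (contract s0 hs IH1) _.
  by rewrite ler_wpM2l.
have e0 : 0 < eta ^+ H by rewrite exprn_gt0.
rewrite /K -mulrA ler_pdivlMl //; apply: le_trans (W_norm _) _.
by apply: le_trans hW _; rewrite mulrC.
Qed.

Let x_ k s := iter k (euler s) (fun j => (j == j0)%:R).
Let x_E k s : x_ k s =1 (fun j => g j + r_ k s j).
Proof.
elim: k => [|k IH] j; first by rewrite /= /r0 addrC subrK.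
rewrite /x_ /r_ !iterS -/(x_ k s) -/(r_ k s) {1}/euler IH /act.
under eq_bigr do rewrite IH mulrDl.
by rewrite big_split /= g_ker add0r -addrA.
Qed.

(* After [N ~ T / s^2] steps the accumulated error [N * O(s^3)] is [O(T s)], while
   the Euler iterates are within [O(exp (- T / 2))] of [g]: take [T] large, then
   [s] small. *)
Lemma trotter_limit (e : R) : 0 < e ->
  exists2 s : R, 0 < s < e & exists N, forall b,
    `|iter N (step s) (P j0) b - act P g b| <= e.
Proof.
move=> e0.
pose X0 := norm1 g + K.
have X00 : 0 <= X0 by rewrite addr_ge0 ?norm1_ge0.
have P0 : 0 <= matnorm P by exact: matnorm_ge0.
(* The constants are chosen in this order: q, the total time [N s^2], brings the Euler deviation
   below [e / 2]; p exceeds [2 A], so that [p t^2] steps at most double a norm and all N steps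
   enlarge it by at most [B]; t is so large that [s = 1 / (p t)] satisfies [s < e],
   [s (matnorm L + 1) <= 1] and [s D <= e / 2]. *)
pose q := Num.bound (4 * (matnorm P * K) / e).
pose p := (Num.bound (2 * A)).+1.
pose B : R := 2 ^+ (p * q).
have B0 : 0 <= B by rewrite exprn_ge0.
pose D := q%:R * (A * (matnorm P * X0) * B).
have D0 : 0 <= D by rewrite !mulr_ge0.
pose t := (Num.bound (1 / e + (matnorm L + 1) + 2 * D / e)).+1.
pose l := (p * t)%N.
have De : 0 <= D / e by rewrite divr_ge0 // ltW.
have e1 : 0 < e^-1 by rewrite invr_gt0.
have tb : 1 / e + (matnorm L + 1) + 2 * D / e < t%:R.
  have h1 : 0 <= 1 / e + (matnorm L + 1) + 2 * D / e.
    by have := L_ge0; rewrite div1r -mulrA; move: De e1; lra.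
  by apply: lt_trans (archi_boundP h1) _; rewrite ltr_nat.
have lt0 : (0 : R) < l%:R by rewrite ltr0n muln_gt0.
have lt1 : t%:R <= l%:R :> R by rewrite ler_nat leq_pmull.
pose s : R := l%:R^-1.
have s0 : 0 < s by rewrite invr_gt0.
have ls : l%:R * s = 1 by rewrite divff // gt_eqF.
have l1 : 1 <= l%:R :> R by rewrite ler1n muln_gt0.
have s1 : s <= 1 by rewrite /s invf_le1.
have se : s < e.
  rewrite -(ltr_pM2l lt0) ls -[ltLHS](mulVf (lt0r_neq0 e0)) ltr_pM2r //.
  by move: tb lt1 L_ge0; rewrite div1r; lra.
have hs : 0 <= s <= 1 by rewrite s1 ltW.
have hL : s ^+ 2 * (matnorm L + 1) <= 1.
  apply: le_trans (_ : s * (matnorm L + 1) <= _).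
    by rewrite ler_wpM2r ?addr_ge0 // expr2 ler_piMl // ltW.
  rewrite -(ler_pM2l lt0) mulrA ls mul1r mulr1.
  by move: tb lt1; rewrite div1r; lra.
pose N := (q * l ^ 2)%N.
have Ns2 : N%:R * s ^+ 2 = q%:R.
  by rewrite /N natrM natrX -mulrA -exprMn ls expr1n mulr1.
exists s; first by rewrite s0.
exists N => b.
pose v k := iter k (step s) (P j0).
have grow k : (k <= N)%N -> (1 + A * s ^+ 2) ^+ k <= B.
  move=> kN; apply: le_trans (_ : (1 + A * s ^+ 2) ^+ N <= _).
    by rewrite ler_weXn2l // lerDl mulr_ge0 // sqr_ge0.
  rewrite (_ : N = ((p * t ^ 2) * (p * q))%N); last exact: steps_split.
  have G0 : 0 <= 1 + A * s ^+ 2 by rewrite addr_ge0 // mulr_ge0 // sqr_ge0.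
  rewrite exprM /B; apply: lerXn2r; rewrite ?nnegrE ?exprn_ge0 //.
  apply: bernoulli_up; first by rewrite mulr_ge0 ?sqr_ge0.
  have -> : (p * t ^ 2)%:R * (A * s ^+ 2) = A / p%:R.
    have p0 : p%:R != 0 :> R by rewrite pnatr_eq0.
    have t0 : t%:R != 0 :> R by rewrite pnatr_eq0.
    by rewrite /s /l !natrM; field; rewrite p0 t0.
  rewrite ler_pdivrMr ?ltr0n //.
  have : 2 * A < p%:R.
    have h1 : 0 <= 2 * A by rewrite mulr_ge0.
    by apply: lt_trans (archi_boundP h1) _; rewrite ltr_nat.
  lra.
have s3 : 0 <= s ^+ 3 by rewrite exprn_ge0 // ltW.
have c0 : 0 <= A * s ^+ 3 * (matnorm P * X0).
  by apply: mulr_ge0; apply: mulr_ge0.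
have xb k : norm1 (x_ k s) <= X0.
  rewrite (norm1_eq (x_E k s)); apply: le_trans (norm1D _ _) _.
  rewrite lerD2l; apply: le_trans (r_bound k (ltW s0) hL) _.
  rewrite ler_piMr // exprn_ile1 //; have := L_ge0; have := sqr_ge0 s; nra.
have err k : (k <= N)%N -> norm1 (fun b => v k b - act P (x_ k s) b)
    <= k%:R * (A * s ^+ 3 * (matnorm P * X0)) * (1 + A * s ^+ 2) ^+ k.
  have G1 : 1 <= 1 + A * s ^+ 2 by rewrite lerDl mulr_ge0 // sqr_ge0.
    elim: k => [|k IH] kN.
    rewrite mul0r mul0r (norm1_eq (_ : _ =1 fun=> 0)).
      by rewrite /norm1 big1 // => i _; rewrite normr0.
    move=> a; rewrite /v /x_ /= /act (bigD1 j0) //= eqxx mul1r big1 ?addr0 ?subrr //.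
    by move=> j /negbTE ->; rewrite mul0r.
  set c := A * s ^+ 3 * _ in c0 IH *.
  have -> : norm1 (fun b => v k.+1 b - act P (x_ k.+1 s) b) =
    norm1 (fun b => step s (fun b => v k b - act P (x_ k s) b) b +
      (step s (act P (x_ k s)) b - act P (euler s (x_ k s)) b)).
    apply: norm1_eq => a; rewrite /v /x_ !iterS -/(v k) -/(x_ k s) addrA; congr (_ - _).
    by rewrite /step /act -big_split /=; apply: eq_bigr => i _; rewrite -mulrDl subrK.
  apply: le_trans (norm1D _ _) _.
  have h1 : norm1 (step s (fun b => v k b - act P (x_ k s) b)) <=
      (1 + A * s ^+ 2) * (k%:R * c * (1 + A * s ^+ 2) ^+ k).
    apply: le_trans (step_bound _ hs) _; rewrite ler_wpM2l ?IH ?(ltnW kN) //.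
    by apply: le_trans G1.
  have h2 : norm1 (fun b => step s (act P (x_ k s)) b - act P (euler s (x_ k s)) b) <= c.
    apply: le_trans (step_euler _ hs) _; rewrite ler_wpM2l //; last by rewrite ler_wpM2l.
    by rewrite mulr_ge0.
  have h3 : c <= c * (1 + A * s ^+ 2) ^+ k.+1 by rewrite ler_peMr // exprn_ege1.
  rewrite -[k.+1]addn1 natrD !mulrDl mul1r addn1; apply: lerD; last by apply: le_trans h3.
  by apply: le_trans h1 _; rewrite [X in _ <= _ * X]exprS mulrCA.
have est1 : `|v N b - act P (x_ N s) b| <= e / 2.
  apply: le_trans (le_norm1 (fun b => v N b - act P (x_ N s) b) b) _.
  apply: le_trans (err N (leqnn _)) _.
  apply: le_trans (_ : N%:R * (A * s ^+ 3 * (matnorm P * X0)) * B <= _).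
    by rewrite ler_wpM2l ?grow // mulr_ge0.
  have -> : N%:R * (A * s ^+ 3 * (matnorm P * X0)) * B = s * D.
    by rewrite /D -Ns2; ring.
  rewrite -(ler_pM2l lt0) mulrA ls mul1r.
  have DE : D = D / e * e by rewrite divfK // gt_eqF.
  rewrite [leLHS]DE [leRHS](_ : _ = l%:R / 2 * e); last by field.
  by rewrite ler_pM2r //; move: tb lt1 L_ge0; rewrite div1r -mulrA; lra.
have est2 : `|act P (x_ N s) b - act P g b| <= e / 2.
  have -> : act P (x_ N s) b - act P g b = act P (r_ N s) b.
    rewrite /act -sumrB; apply: eq_bigr => j _; rewrite x_E; ring.
  apply: le_trans (le_norm1 (act P (r_ N s)) b) _; apply: le_trans (norm1_act _ _) _.
  pose y := (1 - s ^+ 2 / 2) ^+ N.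
  have hr : norm1 (r_ N s) <= K * y by exact: r_bound (ltW s0) hL.
  have y0 : 0 <= y.
    by rewrite /y exprn_ge0 //; have := L_ge0; have := sqr_ge0 s; nra.
  have hy : y * (1 + q%:R / 2) <= 1.
    have -> : q%:R / 2 = N%:R * (s ^+ 2 / 2) by rewrite mulrA Ns2.
    apply: bernoulli_down.
    have := L_ge0; have := sqr_ge0 s; nra.
  apply: le_trans (_ : matnorm P * K * y <= _).
    by rewrite -mulrA ler_wpM2l.
  clearbody y; set Q := matnorm P * K.
  have Q0 : 0 <= Q by rewrite mulr_ge0.
  have qb : 4 * Q / e < q%:R.
    by apply: archi_boundP; rewrite divr_ge0 ?(ltW e0) // mulr_ge0.
  have : 4 * Q <= q%:R * e by rewrite -ler_pdivrMr // ltW.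
  have : 0 <= y * e by rewrite mulr_ge0 // ltW.
  nra.
have -> : iter N (step s) (P j0) b - act P g b =
   (v N b - act P (x_ N s) b) + (act P (x_ N s) b - act P g b) by rewrite addrA subrK.
apply: le_trans (ler_normD _ _) _; lra.
Qed.

End Trotter.

(** * Stable multivariate polynomials *)

Section Scal.
Variables (n : nat) (A : comNzRingType).
Implicit Types (w : 'X_{1..n} -> A) (p : {mpoly A[n]}).

Definition scal w p : {mpoly A[n]} := \sum_(m <- msupp p) (w m * p@_m) *: 'X_[m].

Lemma mcoeff_scal w p m : (scal w p)@_m = w m * p@_m.
Proof.
rewrite /scal raddf_sum /=; under eq_bigr do rewrite mcoeffZ mcoeffX.
have [mp|mp] := boolP (m \in msupp p).
  rewrite (bigD1_seq m) ?msupp_uniq //= eqxx mulr1 big1 ?addr0 // => i /negbTE im.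
  by rewrite im mulr0.
rewrite (memN_msupp_eq0 mp) mulr0 big_seq big1 // => i ip.
have -> : (i == m) = false by apply: contraNF mp => /eqP <-.
by rewrite mulr0.
Qed.

Lemma scal_scal w w' p : scal w (scal w' p) = scal (fun m => w m * w' m) p.
Proof. by apply/mpolyP => m; rewrite !mcoeff_scal mulrA. Qed.

Lemma eq_scal w w' p : w =1 w' -> scal w p = scal w' p.
Proof. by move=> e; apply/mpolyP => m; rewrite !mcoeff_scal e. Qed.

Lemma scal_is_linear w : linear (scal w).
Proof. by move=> c p q; apply/mpolyP => m; rewrite !(mcoeff_scal, mcoeffD, mcoeffZ); ring. Qed.

Lemma scal1 p : scal (fun=> 1) p = p.
Proof. by apply/mpolyP => m; rewrite mcoeff_scal mul1r. Qed.

Lemma msize_scal w p d : (msize p <= d)%N -> (msize (scal w p) <= d)%N.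
Proof.
move=> pd; rewrite msizeE; apply/bigmax_leqP_seq => m + _.
rewrite mcoeff_msupp mcoeff_scal => h; apply: leq_trans pd.
apply: msize_mdeg_lt; rewrite mcoeff_msupp.
by apply: contraNneq h => ->; rewrite mulr0.
Qed.

Lemma scal_sym w p : (forall (m : 'X_{1..n}) (s : 'S_n), w [multinom m (s i) | i < n] = w m) ->
  p \is symmetric -> scal w p \is symmetric.
Proof.
move=> hw /issymP hp; apply/issymP => s; apply/mpolyP => m.
by rewrite mcoeff_sym !mcoeff_scal hw -mcoeff_sym hp.
Qed.

Lemma mcoeff_sum (T : Type) (r : seq T) (Q : T -> {mpoly A[n]}) (m : 'X_{1..n}) :
  (\sum_(i <- r) Q i)@_m = \sum_(i <- r) (Q i)@_m.
Proof. exact: raddf_sum. Qed.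

End Scal.

Section Stability.
Variables (R : rcfType) (n : nat).
Local Notation C := R[i].
Local Notation Im := complex.Im.
Local Notation ev y := (mmap (real_complex R) y).
Implicit Types (y : 'I_n -> C) (p : {mpoly R[n]}).

Definition upper y := forall i, 0 < Im (y i).
Definition stable p := forall y, upper y -> ev y p != 0.

Definition upd y (j : 'I_n) (u : C) : 'I_n -> C := fun i => if i == j then u else y i.

Lemma mmap1_upd y j u (m : 'X_{1..n}) :
  mmap1 (upd y j u) m = \prod_(i < n | i != j) y i ^+ m i * u ^+ m j.
Proof.
rewrite /mmap1 [LHS](bigD1 j) //= mulrC {2}/upd eqxx; congr (_ * _).
by apply: eq_bigr => i /negbTE ij; rewrite /upd ij.
Qed.

Definition section p y (j : 'I_n) : {poly C} :=
  \sum_(m <- msupp p) ((p@_m)%:C%C * \prod_(i < n | i != j) y i ^+ m i) *: 'X^(m j).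

Lemma horner_section p y j u : (section p y j).[u] = ev (upd y j u) p.
Proof.
rewrite /section horner_sum; apply: eq_bigr => m _.
rewrite hornerZ hornerXn -mulrA; congr (_ * _).
by rewrite mmap1_upd.
Qed.

Lemma size_section p y j d : (msize p <= d)%N -> (size (section p y j) <= d)%N.
Proof.
move=> pd; apply: (leq_trans (size_sum _ _ _)).
apply/bigmax_leqP_seq => m mp _; apply: (leq_trans (size_scale_leq _ _)).
rewrite size_polyXn; apply: leq_trans pd; apply: leq_ltn_trans (msize_mdeg_lt mp).
by rewrite mdegE (bigD1 j) //= leq_addr.
Qed.

Lemma section_scal p y j (c : R) u :
  (section (scal (fun m => 1 + c * (m j)%:R) p) y j).[u] =
  (section p y j).[u] + c%:C%C * (u * (section p y j)^`().[u]).
Proof.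
rewrite [LHS]horner_section /section linear_sum /= !horner_sum !mulr_sumr -big_split /=.
rewrite /scal raddf_sum /=; apply: eq_bigr => m _.
rewrite mmapZ mmapX derivZ derivXn !hornerZ hornerMn !hornerXn.
rewrite mmap1_upd.
have e : u * (u ^+ (m j).-1 *+ m j) = u ^+ m j * (m j)%:R.
  case: (m j) => [|k] /=; first by rewrite mulr0n !mulr0.
  by rewrite mulrnAr -exprS mulr_natr.
rewrite !mulrA -[in RHS](mulrA _ u) -!mulrA [u * _]mulrCA !mulrA.
rewrite rmorphM rmorphD rmorphM rmorph1 rmorph_nat /=.
set a := \prod_(i < n | _) _; move: e; set v := _ *+ _; move=> e.
transitivity ((p@_m)%:C%C * a * u ^+ m j +
  c%:C%C * (p@_m)%:C%C * a * (u ^+ m j * (m j)%:R)); first ring.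
by rewrite -e; ring.
Qed.

(** On the section in the variable j, with the others fixed in the upper half-plane, the multiplier
    acts as [1 + c z d/dz]; the sign of c selects [theta_pos] or [theta_neg]. *)
Lemma stable_scal1 p (c : R) (j : 'I_n) d : (msize p <= d.+1)%N -> `|c| * d%:R < 1 ->
  stable p -> stable (scal (fun m => 1 + c * (m j)%:R) p).
Proof.
move=> pd cd hp y hy.
have hf u : 0 < Im u -> (section p y j).[u] != 0.
  move=> hu; rewrite horner_section; apply: hp => i.
  by rewrite /upd; case: eqP.
have yE q : ev y q = (section q y j).[y j].
  rewrite horner_section; apply: eq_bigr => m _; congr (_ * _).
  apply: eq_bigr => i _; rewrite /upd; by case: eqP => // ->.
rewrite yE section_scal; have ps := size_section y j pd.
have yj := hy j; have yu u : Im (y j) <= Im u -> (section p y j).[u] != 0.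
  by move=> hu; apply: hf; apply: lt_le_trans hu.
have [c0|c0|->] := ltrgtP c 0; last by rewrite mul0r addr0 yu.
  have -> : c%:C%C = - (- c)%:C%C :> C by rewrite rmorphN opprK.
  rewrite mulNr; apply: (theta_neg ps) => //; rewrite ?oppr_gt0 ?(ltW yj) //.
  by rewrite -(ltr0_norm c0).
by apply: theta_pos => //; rewrite ltW.
Qed.

Definition gauss (s : R) (m : 'X_{1..n}) : R := \prod_(j < n) (1 - s ^+ 2 * (m j)%:R ^+ 2).

(** [1 - s^2 b^2 = (1 + s b)(1 - s b)] splits the multiplier into first-order operators, two for
    each variable, none of which raises the degree. *)
Lemma stable_gauss p (s : R) d : (msize p <= d.+1)%N -> 0 <= s -> s * d%:R < 1 ->
  stable p -> stable (scal (gauss s) p).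
Proof.
move=> pd s0 sd hp; rewrite (eq_scal (w' := fun m =>
  \prod_(j <- index_enum 'I_n) (1 - s ^+ 2 * (m j)%:R ^+ 2))) //.
elim: (index_enum _) => [|j r IH].
  by rewrite (eq_scal (w' := fun=> 1)) ?scal1 // => m; rewrite big_nil.
rewrite (eq_scal (w' := fun m => (1 + s * (m j)%:R) * ((1 + - s * (m j)%:R) *
    \prod_(i <- r) (1 - s ^+ 2 * (m i)%:R ^+ 2)))); last first.
  by move=> m; rewrite big_cons [RHS]mulrA; congr (_ * _); ring.
rewrite -(scal_scal (fun m => 1 + s * (m j)%:R)) -(scal_scal (fun m => 1 + - s * (m j)%:R)).
apply: (@stable_scal1 _ _ _ d); rewrite ?ger0_norm //; first by do 2 apply: msize_scal.
by apply: (@stable_scal1 _ _ _ d); rewrite ?normrN ?ger0_norm //; apply: msize_scal.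
Qed.

Definition esum y k : C := \sum_(h : {set 'I_n} | #|h| == k) \prod_(i in h) y i.

Lemma ev_mesym y k : ev y (mesym n R k) = esum y k.
Proof.
rewrite /mesym /esum rmorph_sum /=; apply: eq_bigr => h _.
by rewrite rmorph_prod /=; apply: eq_bigr => i _; rewrite mmapX mmap1U.
Qed.

Lemma coef_prodXD y k : (k <= n)%N -> (\prod_(i < n) ('X + (y i)%:P))`_(n - k) = esum y k.
Proof.
move=> kn; pose cs := [tuple - y i | i < n].
have -> : \prod_(i < n) ('X + (y i)%:P) = \prod_(c <- cs) ('X - c%:P).
  by rewrite big_tuple; apply: eq_bigr => i _; rewrite tnth_mktuple polyCN opprK.
have /= -> := mroots_coeff cs (Ordinal (kn : (k < n.+1)%N)).
rewrite /mesym rmorph_sum /= mulr_sumr; apply: eq_bigr => h /eqP hk.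
rewrite rmorph_prod /= -hk -prodr_const -big_split /=; apply: eq_bigr => i _.
by rewrite mevalXU tnth_mktuple mulN1r opprK.
Qed.

Lemma horner_prodXD y u : (\prod_(i < n) ('X + (y i)%:P)).[u] = \prod_(i < n) (u + y i).
Proof. by rewrite horner_prod; apply: eq_bigr => i _; rewrite hornerD hornerX hornerC. Qed.

Lemma prodXD_neq0 y u : upper y -> 0 <= Im u -> (\prod_(i < n) ('X + (y i)%:P)).[u] != 0.
Proof.
move=> hy hu; rewrite horner_prodXD; apply/prodf_neq0 => i _.
by apply: contraTneq (hy i) => /(congr1 (@complex.Im R)); rewrite ImD /=; move: hu; lra.
Qed.

Lemma prodXDE y : \prod_(i < n) ('X + (y i)%:P) =
  \prod_(c <- [seq - y i | i <- index_enum 'I_n]) ('X - c%:P).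
Proof. by rewrite big_map; apply: eq_bigr => i _; rewrite polyCN opprK. Qed.

Lemma size_prodXD y : size (\prod_(i < n) ('X + (y i)%:P)) = n.+1.
Proof. by rewrite prodXDE size_prod_XsubC size_map /index_enum -enumT size_enum_ord. Qed.

Lemma monic_prodXD y : \prod_(i < n) ('X + (y i)%:P) \is monic.
Proof. by rewrite prodXDE monic_prod_XsubC. Qed.

(** Up to the factor [(n - k)!] this is the value at 0 of the derivative of order [n - k] of the
    product of the [X + y_i]. Its roots [- y_i] lie in the open lower half-plane, and repeated
    Gauss-Lucas keeps those of the derivatives there. *)
Lemma esum_neq0 y k : upper y -> (k <= n)%N -> esum y k != 0.
Proof.
move=> hy kn; rewrite -coef_prodXD //; set f := \prod_(i < n) _.
have h j : (j <= n)%N -> forall u, 0 <= Im u -> f^`(j).[u] != 0.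
  elim: j => [|j IH] jn u hu; first by rewrite derivn0; exact: prodXD_neq0.
  rewrite derivnS; apply: gauss_lucas => [|v hv]; last first.
    by apply: IH (ltnW jn) _ _; apply: le_trans hv.
  apply: (@leq_ltn_trans (n - j)); first by lia.
  rewrite ltnNge; apply/negP => /(nth_default 0) /eqP; rewrite coef_derivn subnKC 1?ltnW //.
  rewrite mulrn_eq0 eqn0Ngt ffact_gt0 (ltnW jn) /=.
  have /monicP := monic_prodXD y; rewrite lead_coefE size_prodXD /= => ->.
  by rewrite oner_eq0.
have /(_ 0 (lexx _)) := h (n - k)%N (leq_subr _ _).
rewrite horner_coef0 coef_derivn addn0 ffactnn.
by apply: contraNneq => ->; rewrite mul0rn.
Qed.

(* The lower half-plane zeros of [f = \prod (X + y_i)] survive the two first order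
   operators factoring [e_k |-> (1 - s^2 k^2) e_k]. *)
Lemma esum_scaled y (s : R) : upper y -> 0 < s -> s * n%:R < 1 ->
  exists2 z : 'I_n -> C, upper z &
    forall k, (k <= n)%N -> esum z k = (1 - s ^+ 2 * k%:R ^+ 2)%:C%C * esum y k.
Proof.
move=> hy s0 sn; set f := \prod_(i < n) ('X + (y i)%:P).
have n0 : 0 <= n%:R :> R by [].
have sn1 : 0 < 1 - s * n%:R by rewrite subr_gt0.
have sn2 : 0 < 1 + s * n%:R by nra.
(* Then [1 + c1 (n - k) = (1 - s k) / (1 - s n)] and [1 - c2 (n - k) = (1 + s k) / (1 + s n)], so
   the two operators multiply the coefficient [e_k] of index [n - k] by [(1 - s^2 k^2) / a], for the
   [a] below; the factor [a] then restores a monic polynomial. *)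
pose c1 := s / (1 - s * n%:R); pose c2 := s / (1 + s * n%:R).
have c10 : 0 < c1 by rewrite divr_gt0.
have c20 : 0 < c2 by rewrite divr_gt0.
have c2n : c2 * n%:R < 1.
  by rewrite /c2 mulrAC ltr_pdivrMr //; nra.
pose f1 := f + c1%:C%C *: ('X * f^`()).
pose f2 := f1 - c2%:C%C *: ('X * f1^`()).
have hf u : 0 <= Im u -> f.[u] != 0 by exact: prodXD_neq0.
have hf1 u : 0 <= Im u -> f1.[u] != 0.
  move=> hu; rewrite hornerD hornerZ hornerM hornerX theta_pos // => v hv.
  by apply: hf; apply: le_trans hv.
have coefXd (g : {poly C}) k : ('X * g^`())`_k = g`_k * k%:R.
  by rewrite coefXM coef_deriv; case: k => [|k] /=; rewrite ?mulr0 // mulr_natr.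
have sf : (size f <= n.+1)%N by rewrite size_prodXD.
have wide (g : {poly C}) : (size g <= n.+1)%N -> (size ('X * g^`())%R <= n.+1)%N.
  move=> sg; apply/leq_sizeP => k hk; rewrite coefXd nth_default ?mul0r //.
  exact: leq_trans sg hk.
have sf1 : (size f1 <= n.+1)%N.
  rewrite (leq_trans (size_polyD _ _)) // geq_max sf.
  by rewrite (leq_trans (size_scale_leq _ _)) // wide.
have hf2 u : 0 <= Im u -> f2.[u] != 0.
  move=> hu; rewrite hornerD hornerN hornerZ hornerM hornerX.
  apply: (theta_neg sf1) => // v hv; apply: hf1; last exact: le_trans hv.
  exact: ltW.
have sf2 : (size f2 <= n.+1)%N.
  rewrite (leq_trans (size_polyD _ _)) // geq_max sf1 size_polyN.
  by rewrite (leq_trans (size_scale_leq _ _)) // wide.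
pose a := ((1 - s * n%:R) * (1 + s * n%:R))%:C%C : C.
have a0 : a != 0 by rewrite /a eq_complex /= gt_eqF // mulr_gt0.
have f2E k : (k <= n)%N ->
    a * f2`_(n - k) = (1 - s ^+ 2 * k%:R ^+ 2)%:C%C * esum y k.
  move=> kn; rewrite coefB coefZ coefXd coefD coefZ coefXd -coef_prodXD // -/f.
  have -> : f`_(n - k) + c1%:C%C * (f`_(n - k) * (n - k)%:R) -
      c2%:C%C * ((f`_(n - k) + c1%:C%C * (f`_(n - k) * (n - k)%:R)) * (n - k)%:R) =
      ((1 + c1 * (n - k)%:R) * (1 - c2 * (n - k)%:R))%:C%C * f`_(n - k).
    by rewrite !(rmorphM, rmorphD, rmorphN, rmorph1, rmorph_nat) /=; ring.
  rewrite mulrA -rmorphM; congr (_%:C%C * _).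
  by rewrite natrB // /c1 /c2; field; rewrite !gt_eqF.
have mon : a *: f2 \is monic.
  rewrite monicE lead_coefE; have -> : size (a *: f2)%R = n.+1.
    apply/eqP; rewrite eqn_leq (leq_trans (size_scale_leq _ _)) //=.
    rewrite ltnNge; apply/negP => /(nth_default 0) /eqP.
    rewrite coefZ -[n in _`_n]subn0 f2E // expr0n mulr0 subr0 mul1r.
    by rewrite (negbTE (esum_neq0 hy _)).
  rewrite /= coefZ -[n in _`_n]subn0 f2E // expr0n mulr0 subr0 mul1r.
  rewrite -coef_prodXD // subn0; have /monicP := monic_prodXD y.
  by rewrite lead_coefE size_prodXD /= => ->.
have g0 : a *: f2 != 0 by apply: monic_neq0.
have [r gE szr] := poly_roots g0.
rewrite (monicP mon) scale1r in gE.
have sr : size r = n.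
  have := szr; have : size (a *: f2) = n.+1; last by move=> -> [].
  apply/eqP; rewrite eqn_leq (leq_trans (size_scale_leq _ _)) //=.
  rewrite ltnNge; apply/negP => /(nth_default 0) /eqP.
  rewrite coefZ -[n in _`_n]subn0 f2E // expr0n mulr0 subr0 mul1r.
  by rewrite (negbTE (esum_neq0 hy _)).
exists (fun i => - r`_i).
  move=> i; rewrite ImN oppr_gt0 ltNge; apply/negP => /hf2; apply/negP; rewrite negbK.
  have : root (a *: f2) r`_i by rewrite gE root_prod_XsubC mem_nth // sr.
  by rewrite rootZ.
move=> k kn; rewrite -f2E // -coefZ gE -coef_prodXD //.
suff -> : \prod_(i < n) ('X + (- r`_i)%:P) = \prod_(z <- r) ('X - z%:P) by [].
rewrite [RHS](big_nth 0) [in RHS]sr [RHS]big_mkord; apply: eq_bigr => i _.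
by rewrite polyCN.
Qed.
End Stability.

(** * Limits of iterated stability preservers *)

Section Jet.
Variable R : comNzRingType.

(* [p = 1 + c X^2 + O(X^3)] *)
Definition jet2 (p : {poly R}) (c : R) := [/\ p`_0 = 1, p`_1 = 0 & p`_2 = c].

Lemma coefM_low (p q : {poly R}) : [/\ (p * q)`_0 = p`_0 * q`_0,
  (p * q)`_1 = p`_0 * q`_1 + p`_1 * q`_0 &
  (p * q)`_2 = p`_0 * q`_2 + p`_1 * q`_1 + p`_2 * q`_0].
Proof. by rewrite !coefM !big_ord_recl !big_ord0 /= !addr0 addrA. Qed.

Lemma jet2M p q c d : jet2 p c -> jet2 q d -> jet2 (p * q) (c + d).
Proof.
case=> p0 p1 p2 [q0 q1 q2]; have [h0 h1 h2] := coefM_low p q.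
by split; rewrite ?h0 ?h1 ?h2 ?p0 ?p1 ?p2 ?q0 ?q1 ?q2 //; ring.
Qed.

Lemma jet2_1 : jet2 1 0.
Proof. by split; rewrite coef1. Qed.

Lemma jet2X2 (c : R) : jet2 (1 + c *: 'X^2) c.
Proof. by split; rewrite coefD coef1 coefZ coefXn /= ?mulr0 ?mulr1 ?addr0 ?add0r. Qed.

Lemma horner_quad (c s : R) : (1 + c *: 'X^2).[s] = 1 + c * s ^+ 2.
Proof. by rewrite !hornerE. Qed.

Lemma jet2_prod (T : Type) (r : seq T) (F : T -> {poly R}) (c : T -> R) :
  (forall i, jet2 (F i) (c i)) -> jet2 (\prod_(i <- r) F i) (\sum_(i <- r) c i).
Proof.
move=> h; elim: r => [|i r IH]; first by rewrite !big_nil; exact: jet2_1.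
by rewrite !big_cons; exact: jet2M.
Qed.

Lemma jet2_exp p c k : jet2 p c -> jet2 (p ^+ k) (c *+ k).
Proof.
move=> h; elim: k => [|k IH]; first by rewrite expr0 mulr0n; exact: jet2_1.
by rewrite exprS mulrS; exact: jet2M.
Qed.

End Jet.

Section Generator.
Variables (R : realType) (n w : nat).
Local Notation S := [tuple mesym n R i.+1 | i < n].
Local Notation C := R[i].
Local Notation Im := complex.Im.
Local Notation ev y := (mmap (real_complex R) y).
Implicit Types (t p : {mpoly R[n]}) (m : 'X_{1..n}).

Definition gaussp m : {poly R} := \prod_(j < n) (1 + (- (m j)%:R ^+ 2) *: 'X^2).

Lemma horner_gaussp m s : (gaussp m).[s] = gauss s m.
Proof.
rewrite /gaussp horner_prod; apply: eq_bigr => j _.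
by rewrite horner_quad mulNr mulrC.
Qed.

Lemma jet2_gaussp m : jet2 (gaussp m) (- \sum_(j < n) (m j)%:R ^+ 2).
Proof. by rewrite -sumrN; apply: jet2_prod => j; exact: jet2X2. Qed.

Lemma size_gaussp m : (size (gaussp m) <= (2 * n).+1)%N.
Proof.
have h r : (size (\prod_(j <- r) (1 + (- (m j)%:R ^+ 2) *: 'X^2) : {poly R})%R
    <= (2 * size r).+1)%N.
  elim: r => [|j r IH]; first by rewrite big_nil size_poly1.
  rewrite big_cons; apply: (leq_trans (size_polyMleq _ _)).
  have : (size (1 + (- (m j)%:R ^+ 2) *: 'X^2 : {poly R})%R <= 3)%N.
    rewrite (leq_trans (size_polyD _ _)) // geq_max size_poly1 /=.
    by rewrite (leq_trans (size_scale_leq _ _)) // size_polyXn.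
  move: IH => /=; lia.
have := h (index_enum 'I_n).
by have -> : size (index_enum 'I_n) = n by rewrite /index_enum -enumT size_enum_ord.
Qed.

Definition gauss_coef r p := scal (fun m => (gaussp m)`_r) p.
(** The coefficient of [s^r] in the multiplier [gauss s], read in the variables [e_1, ..., e_n]: the
    multiplier is invariant under permutations, hence preserves symmetric polynomials, and [symf]
    lifts the result by the fundamental theorem. *)
Definition gauss_lift r t : {mpoly R[n]} := symf (gauss_coef r (t \mPo S)).

Lemma comp_sym t : t \mPo S \is symmetric.
Proof. by apply: mcomp_sym => i; rewrite -tnth_nth tnth_mktuple; exact: mesym_sym. Qed.

Lemma gauss_liftP r t : gauss_lift r t \mPo S = gauss_coef r (t \mPo S).
Proof.
rewrite -symfP //; apply: scal_sym; last exact: comp_sym.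
move=> m s; suff -> : gaussp [multinom m (s i) | i < n] = gaussp m by [].
rewrite /gaussp [RHS](reindex_inj (@perm_inj _ s)) /=.
by apply: eq_bigr => i _; rewrite mnmE.
Qed.

Lemma comp_sum (T : Type) (r : seq T) (Q : T -> {mpoly R[n]}) :
  (\sum_(i <- r) Q i) \mPo S = \sum_(i <- r) (Q i \mPo S).
Proof. exact: raddf_sum. Qed.

Lemma gauss_lift_homog r t : t \is w.-homog for mnmwgt -> gauss_lift r t \is w.-homog for mnmwgt.
Proof.
rewrite !mwmwgt_homogE gauss_liftP => /dhomogP h; apply/dhomogP => m.
rewrite mcoeff_msupp mcoeff_scal => hm; apply: h; rewrite mcoeff_msupp.
by apply: contraNneq hm => ->; rewrite mulr0.
Qed.

Lemma gauss_lift0 t : gauss_lift 0 t = t.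
Proof.
apply: msym_fundamental_un; rewrite gauss_liftP; apply/mpolyP => m.
by rewrite mcoeff_scal; have [-> _ _] := jet2_gaussp m; rewrite mul1r.
Qed.

Lemma gauss_lift1 t : gauss_lift 1 t = 0.
Proof.
apply: msym_fundamental_un; rewrite gauss_liftP comp_mpoly0; apply/mpolyP => m.
by rewrite mcoeff_scal mcoeff0; have [_ -> _] := jet2_gaussp m; rewrite mul0r.
Qed.

Definition sqdeg m : R := \sum_(j < n) (m j)%:R ^+ 2.

Lemma gauss_lift2 t : gauss_lift 2 t \mPo S = - scal sqdeg (t \mPo S).
Proof.
rewrite gauss_liftP; apply/mpolyP => m; rewrite mcoeffN !mcoeff_scal.
by have [_ _ ->] := jet2_gaussp m; rewrite mulNr.
Qed.

Lemma gauss_lift_linear r : linear (gauss_lift r).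
Proof.
move=> c t u; apply: msym_fundamental_un; rewrite linearP /= !gauss_liftP linearP /=.
exact: scal_is_linear.
Qed.

Variable kappa : R.
(** The weight counts [e_k] k times and so dominates the degree: all monomials of weight w have
    degree at most w. On the other monomials of [I], [Mat] is the identity. *)
Let I : finType := 'X_{1..n < w.+1}.

Definition esq m : R := \sum_(k < n) ((k.+1)%:R ^+ 2) *+ m k.

Definition diagp m : {poly R} :=
  (1 + kappa *: 'X^2) * \prod_(k < n) (1 + (- (k.+1)%:R ^+ 2) *: 'X^2) ^+ m k.

Lemma jet2_diagp m : jet2 (diagp m) (kappa - esq m).
Proof.
apply: jet2M; first exact: jet2X2.
rewrite /esq -sumrN; apply: jet2_prod => k.
by rewrite -mulNrn; apply: jet2_exp; exact: jet2X2.
Qed.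

(** [gaussp] has degree at most 2n, so nothing is lost; the two further places make the coefficients
    0, 1 and 2 available even when n = 0. *)
Definition series (a b : I) : {poly R} := \poly_(r < (2 * n).+3) (gauss_lift r 'X_[a])@_b.

(* In the monomials of weight [w] in the elementary symmetric polynomials, the
   matrix of [e_k |-> (1 - s^2 k^2) e_k] followed by [gauss s], as a polynomial
   in [s]; the factor [1 + kappa s^2] brings the top eigenvalue to 1 up to
   second order. *)
Definition Mat (a b : I) : {poly R} :=
  if mnmwgt a == w then diagp a * series a b else ((a == b)%:R)%:P.

Lemma Mat_low (a b : I) : [/\ (Mat a b)`_0 = (a == b)%:R, (Mat a b)`_1 = 0
  & mnmwgt a = w -> (Mat a b)`_2 =
      (gauss_lift 2 'X_[a])@_b + (kappa - esq a) * (a == b)%:R].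
Proof.
rewrite /Mat; case: eqP => [aw|//]; last by rewrite !coefC.
have [h0 h1 h2] := coefM_low (diagp a) (series a b).
have [d0 d1 d2] := jet2_diagp a.
have [s0 s1 s2] : [/\ (series a b)`_0 = (a == b)%:R, (series a b)`_1 = 0
    & (series a b)`_2 = (gauss_lift 2 'X_[a])@_b].
  by rewrite /series !coef_poly /= gauss_lift0 gauss_lift1 mcoeffX mcoeff0.
by rewrite h0 h1 h2 d0 d1 d2 s0 s1 s2; split=> [||_]; ring.
Qed.

Definition mpoly_of (v : I -> R) : {mpoly R[n]} := \sum_a v a *: 'X_[a].

Lemma mcoeff_mpoly_of v (a : I) : (mpoly_of v)@_a = v a.
Proof.
rewrite /mpoly_of raddf_sum /=; under eq_bigr do rewrite mcoeffZ mcoeffX.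
by under eq_bigr => i _ do rewrite -val_eqE /=; exact: sum_delta.
Qed.

Lemma mdeg_mnmwgt m : (mdeg m <= mnmwgt m)%N.
Proof. by rewrite mdegE /mnmwgt; apply: leq_sum => i _; rewrite leq_pmulr. Qed.

Lemma mpoly_ofK t : t \is w.-homog for mnmwgt -> mpoly_of (fun a => t@_a) = t.
Proof.
move=> /dhomogP ht; apply/mpolyP => m.
have [mw|mw] := boolP (mdeg m < w.+1)%N.
  by have := mcoeff_mpoly_of (fun a : I => t@_a) (BMultinom mw).
have -> : t@_m = 0.
  apply: memN_msupp_eq0; apply: contra mw => /ht <-; exact: mdeg_mnmwgt.
rewrite /mpoly_of raddf_sum big1 //= => a _; rewrite mcoeffZ mcoeffX.
have -> : (val a == m) = false by apply: contraNF mw => /eqP <-; exact: bmdeg.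
by rewrite mulr0.
Qed.

Definition weight_w (v : I -> R) := forall a : I, mnmwgt a != w -> v a = 0.

Lemma mpoly_of_homog v : weight_w v -> mpoly_of v \is w.-homog for mnmwgt.
Proof.
move=> gv; apply/dhomogP => m; rewrite mcoeff_msupp => hm; apply/eqP.
apply: contraNT hm => mw; rewrite /mpoly_of raddf_sum big1 //= => a _.
rewrite mcoeffZ mcoeffX; case: eqP => [e|]; last by rewrite mulr0.
by rewrite gv ?mul0r // e.
Qed.

Lemma mpoly_of_step s v : weight_w v -> mpoly_of (step Mat s v) =
  \sum_(a : I) (v a * (diagp a).[s]) *:
     \sum_(r < (2 * n).+3) s ^+ r *: gauss_lift r 'X_[a].
Proof.
move=> gv; rewrite /mpoly_of /step /act.
under eq_bigr do rewrite scaler_suml.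
rewrite exchange_big /=; apply: eq_bigr => a _.
have [aw|aw] := eqVneq (mnmwgt a) w; last first.
  by rewrite gv // mul0r scale0r big1 // => b _; rewrite mul0r scale0r.
have hX r : gauss_lift r 'X_[a] = mpoly_of (fun b => (gauss_lift r 'X_[a])@_b).
  by rewrite mpoly_ofK //; apply: gauss_lift_homog; rewrite dhomogX; apply/eqP.
rewrite /Mat aw eqxx; under eq_bigr do rewrite hornerM mulrA -scalerA.
rewrite -scaler_sumr; congr (_ *: _).
under [RHS]eq_bigr do rewrite hX /mpoly_of scaler_sumr.
rewrite exchange_big /=; apply: eq_bigr => b _.
rewrite /series horner_poly scaler_suml; apply: eq_bigr => r _.
by rewrite scalerA mulrC.
Qed.

Lemma weight_w_step s v : weight_w v -> weight_w (step Mat s v).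
Proof.
move=> gv a aw; rewrite -mcoeff_mpoly_of mpoly_of_step //.
have: \sum_(a : I) (v a * (diagp a).[s]) *: (\sum_(r < (2 * n).+3) s ^+ r *: gauss_lift r 'X_[a])
    \is w.-homog for mnmwgt.
  apply: rpred_sum => b _; have [bw|bw] := eqVneq (mnmwgt b) w; last first.
    by rewrite gv // mul0r scale0r rpred0.
  apply: dhomogZ; apply: rpred_sum => r _; apply: dhomogZ.
  by apply: gauss_lift_homog; rewrite dhomogX; apply/eqP.
by move=> /dhomog_nemf_coeff; apply.
Qed.

Lemma ev_compX y m : ev y ('X_[m] \mPo S) = \prod_(k < n) esum y k.+1 ^+ m k.
Proof.
rewrite comp_mpolyX rmorph_prod /=; apply: eq_bigr => k _.
by rewrite rmorphXn /= tnth_mktuple ev_mesym.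
Qed.

Lemma ev_mpoly_of y v : ev y (mpoly_of v \mPo S) =
  \sum_(a : I) (v a)%:C%C * \prod_(k < n) esum y k.+1 ^+ a k.
Proof.
rewrite /mpoly_of linear_sum /= raddf_sum /=; apply: eq_bigr => a _.
by rewrite linearZ /= mmapZ ev_compX.
Qed.

Lemma horner_diagp s m : (diagp m).[s] =
  (1 + kappa * s ^+ 2) * \prod_(k < n) (1 - s ^+ 2 * (k.+1)%:R ^+ 2) ^+ m k.
Proof.
rewrite /diagp hornerM horner_quad; congr (_ * _).
rewrite horner_prod; apply: eq_bigr => k _; rewrite horner_exp; congr (_ ^+ _).
by rewrite horner_quad mulNr mulrC.
Qed.

(** Up to the nonzero factor [1 + kappa s^2], substituting the scaled [e_k] and evaluating at y is
    evaluating the original form at the point z of [esum_scaled], again in the upper half-plane.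
    Then [stable_gauss] applies, the weight w bounding the degree. *)
Lemma stable_step s v : weight_w v -> 0 < s -> s * n%:R < 1 -> s * w%:R < 1 ->
  1 + kappa * s ^+ 2 != 0 -> stable (mpoly_of v \mPo S) -> stable (mpoly_of (step Mat s v) \mPo S).
Proof.
move=> gv s0 sn sw ks hv.
pose q := \sum_(a : I) (v a * (diagp a).[s]) *: ('X_[a] \mPo S).
have -> : mpoly_of (step Mat s v) \mPo S = scal (gauss s) q.
  rewrite mpoly_of_step // comp_sum.
  apply/mpolyP => m; rewrite mcoeff_scal /q !mcoeff_sum mulr_sumr; apply: eq_bigr => a _.
  rewrite comp_mpolyZ comp_sum !mcoeffZ [RHS]mulrCA; congr (_ * _).
  rewrite mcoeff_sum -horner_gaussp.
  rewrite (@horner_coef_wide _ (2 * n).+3); last by have := size_gaussp m; lia.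
  rewrite mulr_suml; apply: eq_bigr => r _.
  by rewrite comp_mpolyZ gauss_liftP mcoeffZ mcoeff_scal mulrCA mulrA.
apply: (@stable_gauss _ _ _ _ w) => //; last 1 first.
- move=> y hy; have [z hz ze] := esum_scaled hy s0 sn.
  have -> : ev y q = (1 + kappa * s ^+ 2)%:C%C * ev z (mpoly_of v \mPo S).
    rewrite /q raddf_sum /= ev_mpoly_of mulr_sumr; apply: eq_bigr => a _.
    rewrite mmapZ ev_compX horner_diagp.
    have -> : \prod_(k < n) esum z k.+1 ^+ a k =
        (\prod_(k < n) (1 - s ^+ 2 * (k.+1)%:R ^+ 2) ^+ a k)%:C%C *
        \prod_(k < n) esum y k.+1 ^+ a k.
      rewrite rmorph_prod -big_split /=; apply: eq_bigr => k _.
      by rewrite rmorphXn -exprMn ze.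
    by rewrite !rmorphM /=; ring.
  by rewrite mulf_neq0 ?hv // eq_complex /= negb_and ks.
- rewrite msizeE; apply/bigmax_leqP_seq => m + _; rewrite mcoeff_msupp => hm.
  rewrite ltnS; apply: contraNT hm; rewrite -ltnNge => wm.
  rewrite /q raddf_sum big1 //= => a _; rewrite mcoeffZ.
  have [aw|aw] := eqVneq (mnmwgt a) w; last by rewrite gv // !mul0r.
  have hd := @dhomog_XS n R a; rewrite (dhomog_nemf_coeff hd) ?mulr0 //.
  by rewrite aw; apply: contraTneq wm => <-; rewrite ltnn.
- exact: ltW.
Qed.

Variables (J : finType) (F : J -> {mpoly R[n]}).
Variables (L : J -> J -> R) (h : J -> nat) (j0 : J) (g : J -> R).
Hypothesis F_homog : forall j, F j \is w.-homog for mnmwgt.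
Hypothesis L_diag : forall j, j != j0 -> L j j <= -1.
Hypothesis L_up : forall j k, L j k != 0 -> j != k -> (h j < h k)%N.
Hypothesis h_j0 : h j0 = 0%N.
Hypothesis g_j0 : g j0 = 1.
Hypothesis g_ker : forall k, \sum_j g j * L j k = 0.
Hypothesis L_gen : forall j, - scal sqdeg (F j \mPo S) +
  ((kappa *: F j - scal esq (F j)) \mPo S) = (\sum_k L j k *: F k) \mPo S.
Hypothesis kappa_ge0 : 0 <= kappa.
Hypothesis stable0 : stable (F j0 \mPo S).

Definition limit_form : {mpoly R[n]} := \sum_j g j *: F j.

Let P (j : J) (a : I) : R := (F j)@_a.

Let P_gen j (b : I) :
  \sum_a P j a * (Mat a b)`_2 = \sum_k L j k * P k b.
Proof.
have e : gauss_lift 2 (F j) + (kappa *: F j - scal esq (F j)) = \sum_k L j k *: F k.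
  by apply: msym_fundamental_un; rewrite raddfD /= gauss_lift2 L_gen.
have -> : \sum_k L j k * P k b = (\sum_k L j k *: F k)@_b.
  by rewrite raddf_sum /=; apply: eq_bigr => k _; rewrite mcoeffZ.
rewrite -e mcoeffD mcoeffB mcoeffZ mcoeff_scal.
have -> : gauss_lift 2 (F j) = \sum_(a : I) P j a *: gauss_lift 2 'X_[a].
  rewrite -{1}(mpoly_ofK (F_homog j)) /mpoly_of.
  have addl : {morph gauss_lift 2 : t u / t + u}.
    by move=> t u; have := gauss_lift_linear 2 1 t u; rewrite !scale1r.
  have l0 : gauss_lift 2 0 = 0 
    by have := addl 0 0; rewrite addr0 => /eqP;
    rewrite -subr_eq0 opprD addrA subrr add0r oppr_eq0 => /eqP.
  rewrite (big_morph _ addl l0); apply: eq_bigr => a _.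
  by have := gauss_lift_linear 2 (P j a) 'X_[a] 0; rewrite l0 !addr0.
rewrite mcoeff_sum -[esq b * _]mulrC -[X in _ + (X - _)]mulrC -mulrBr.
rewrite -[(F j)@_b]/(P j b) -(sum_delta (fun a => P j a * (kappa - esq a)) b) -big_split /=.
apply: eq_bigr => a _; rewrite mcoeffZ -mulrA -mulrDr.
have [aw|aw] := eqVneq (mnmwgt a) w; last first.
  by rewrite /P (dhomog_nemf_coeff (F_homog j)) // !mul0r.
by have [_ _ ->] := Mat_low a b.
Qed.

Let vlim (a : I) : R := act P g a.
Let vlimE : mpoly_of vlim = limit_form.
Proof.
rewrite /mpoly_of /vlim /act /limit_form; under eq_bigr do rewrite scaler_suml.
rewrite exchange_big /=; apply: eq_bigr => j _.
rewrite -[in RHS](mpoly_ofK (F_homog j)) /mpoly_of scaler_sumr; apply: eq_bigr => a _.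
by rewrite scalerA.
Qed.

Let weight_w_F j : weight_w (P j).
Proof. by move=> a aw; rewrite /P (dhomog_nemf_coeff (F_homog j)). Qed.

Let stable_iter s N : 0 < s -> s * n%:R < 1 -> s * w%:R < 1 ->
  weight_w (iter N (step Mat s) (P j0)) /\
  stable (mpoly_of (iter N (step Mat s) (P j0)) \mPo S).
Proof.
move=> s0 sn sw; elim: N => [|N [IH1 IH2]] /=.
  by split; [exact: weight_w_F | rewrite mpoly_ofK].
split; first exact: weight_w_step.
by apply: stable_step => //; rewrite gt_eqF // ltr_wpDr // mulr_ge0 // sqr_ge0.
Qed.

Let approx (e : R) : 0 < e -> exists v : I -> R,
  [/\ weight_w v, stable (mpoly_of v \mPo S) & forall a, `|v a - vlim a| <= e].
Proof.
move=> e0; pose e' := Num.min e (Num.min (n.+1)%:R^-1 (w.+1)%:R^-1).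
have e'0 : 0 < e' by rewrite !lt_min e0 !invr_gt0 !ltr0n.
have Mat0 a b : (Mat a b)`_0 = (a == b)%:R by have [] := Mat_low a b.
have Mat1 a b : (Mat a b)`_1 = 0 by have [] := Mat_low a b.
have [s /andP[s0 se] [N hN]] := trotter_limit Mat0 Mat1 P_gen L_diag L_up h_j0 g_j0 g_ker e'0.
move: se; rewrite !lt_min => /and3P[se sn sw].
have hb k : s < (k.+1)%:R^-1 -> s * k%:R < 1.
  rewrite -[_^-1]mul1r ltr_pdivlMr ?ltr0n // => hk.
  by apply: le_lt_trans hk; rewrite ler_pM2l // ler_nat.
have [g1 g2] := stable_iter N s0 (hb _ sn) (hb _ sw).
exists (iter N (step Mat s) (P j0)); split=> // a.
by apply: le_trans (hN a) _; rewrite ge_min lexx.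
Qed.

Let line (y y1 : 'I_n -> C) (i : 'I_n) : {poly C} := (y i)%:P + (y1 i - y i) *: 'X.
Let restr y y1 (p : {mpoly R[n]}) : {poly C} :=
  mmap (polyC \o real_complex R) (line y y1) p.

Let horner_restr y y1 p u :
  (restr y y1 p).[u] = ev (fun i => y i + u * (y1 i - y i)) p.
Proof.
rewrite /restr /mmap horner_sum; apply: eq_bigr => m _.
rewrite hornerM hornerC; congr (_ * _); rewrite /mmap1 horner_prod.
by apply: eq_bigr => i _; rewrite horner_exp hornerD hornerZ hornerC hornerX mulrC.
Qed.

Let size_restr y y1 p d : (msize p <= d.+1)%N -> (size (restr y y1 p) <= d.+1)%N.
Proof.
move=> pd; apply: (leq_trans (size_sum _ _ _)); apply/bigmax_leqP_seq => m mp _.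
rewrite /= mul_polyC (leq_trans (size_scale_leq _ _)) //.
apply: leq_trans pd; apply: leq_trans (msize_mdeg_lt mp).
have hq r : (size (\prod_(i <- r) line y y1 i ^+ m i)%R <= (\sum_(i <- r) m i).+1)%N.
  elim: r => [|i r IH]; first by rewrite !big_nil size_poly1.
  rewrite !big_cons; apply: (leq_trans (size_polyMleq _ _)).
  have : (size (line y y1 i ^+ m i)%R <= (m i).+1)%N.
    apply: (leq_trans (size_poly_exp_leq _ _)); rewrite ltnS.
    have : (size (line y y1 i) <= 2)%N.
      rewrite (leq_trans (size_polyD _ _)) // geq_max (leq_trans (size_polyC_leq1 _)) //.
      by rewrite (leq_trans (size_scale_leq _ _)) // size_polyX.
    by case: (size _) => [|[|[|k]]] //= _; rewrite ?mul0n ?mul1n.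
  move: IH => /=; lia.
by rewrite mdegE; exact: hq.
Qed.

Let upper_nbhs (y y1 : 'I_n -> C) : upper y -> exists2 r : R, 0 < r &
  forall u : C, `|0 - u| < r%:C%C -> upper (fun i => y i + u * (y1 i - y i)).
Proof.
(* [D] exceeds every displacement and [q^-1] is at most every [Im (y i)], so the radius [1 / (q D)]
   keeps each coordinate in the upper half-plane. *)
pose d i := complex.Re `|y1 i - y i|; pose D := 1 + \sum_i d i.
pose q := 1 + \sum_i (Im (y i))^-1 => hy.
have d0 i : 0 <= d i by rewrite /d -ler0c RRe_real // ger0_real.
have D0 : 0 < D by rewrite ltr_pwDl // sumr_ge0.
have i0 i : 0 <= (Im (y i))^-1 by rewrite invr_ge0 ltW // hy.
have q0 : 0 < q by rewrite ltr_pwDl // sumr_ge0.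
exists (q * D)^-1; first by rewrite invr_gt0 mulr_gt0.
move=> u; rewrite sub0r normrN => hu i.
pose r := complex.Re `|u|; have rE : `|u| = r%:C%C by rewrite RRe_real // ger0_real.
have r0 : 0 <= r by rewrite -ler0c -rE.
have hr : r * d i < Im (y i).
  have h1 : r * D < q^-1.
    by rewrite -ltr_pdivlMr // -invfM -ltcR -rE.
  have h2 : q^-1 <= Im (y i).
    rewrite -[leRHS]invrK lef_pV2 ?posrE ?invr_gt0 ?hy //.
    rewrite /q (bigD1 i) //= addrCA lerDl addr_ge0 // sumr_ge0 //.
  have h3 : d i <= D.
    rewrite /D (bigD1 i) //= addrCA lerDl addr_ge0 // sumr_ge0 //.
  apply: lt_le_trans h2; apply: le_lt_trans h1; exact: ler_wpM2l.
have ImRe (x : C) : `|Im x| <= complex.Re `|x|.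
  by rewrite normc_def /= -sqrtr_sqr ler_wsqrtr // lerDr sqr_ge0.
have : `|Im (u * (y1 i - y i))| <= r * d i.
  apply: le_trans (ImRe _) _; rewrite normrM rE.
  have -> : `|y1 i - y i| = (d i)%:C%C by rewrite RRe_real // ger0_real.
  by rewrite -rmorphM.
by rewrite ImD ler_norml => /andP[+ _]; lra.
Qed.

(* Hurwitz along the complex line through [y] and [y1]: by [norm_horner_le] the
   value of a stable form of bounded degree at [y1] is at most a constant times
   its value at [y], and this bound passes to the limit. *)
Lemma stable_limit (y y1 : 'I_n -> C) : upper y -> upper y1 ->
  ev y1 (limit_form \mPo S) != 0 -> ev y (limit_form \mPo S) != 0.
Proof.
move=> hy hy1 h1; apply/eqP => h0.
have [r r0 hr] := upper_nbhs y1 hy.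
have rC : 0 < r%:C%C :> C by rewrite ltcR.
pose c (z : 'I_n -> C) : C := \sum_(a : I) `|\prod_(k < n) esum z k.+1 ^+ a k|.
have c0 z : 0 <= c z by apply: sumr_ge0.
pose B : C := (1 + `|1 - 0| / r%:C%C) ^+ w.
have B0 : 0 <= B by rewrite exprn_ge0 // addr_ge0 // divr_ge0 // ltW.
pose V := ev y1 (limit_form \mPo S).
have V0 : 0 < `|V| by rewrite normr_gt0.
pose K := complex.Re (c y1 + B * c y).
have KE : K%:C%C = c y1 + B * c y by rewrite RRe_real // ger0_real // addr_ge0 // mulr_ge0.
have K0 : 0 <= K by rewrite -lecR KE addr_ge0 // mulr_ge0.
pose X := complex.Re `|V|.
have XE : X%:C%C = `|V| by rewrite RRe_real // ger0_real.
have X0 : 0 < X by rewrite -ltcR XE.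
(* If the limit vanished at y, an e-close stable form would give [|V| <= e K], and this e makes
   [e K < |V|]. *)
pose e := X / (K + 1) / 2.
have e0 : 0 < e by rewrite !divr_gt0 // ltr_wpDl.
have [v [gv sv hv]] := approx e0.
have close (z : 'I_n -> C) : `|ev z (mpoly_of v \mPo S) - ev z (limit_form \mPo S)| <= e%:C%C * c z.
  rewrite -vlimE !ev_mpoly_of -sumrB; apply: le_trans (ler_norm_sum _ _ _) _.
  rewrite mulr_sumr; apply: ler_sum => a _; rewrite -mulrBl normrM ler_wpM2r //.
  by rewrite -rmorphB /= normc_def /= expr0n addr0 sqrtr_sqr lecR.
have sz : (size (restr y y1 (mpoly_of v \mPo S)) <= w.+1)%N.
  apply: size_restr; have := mpoly_of_homog gv; rewrite mwmwgt_homogE => /dhomogP hd.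
  by rewrite msizeE; apply/bigmax_leqP_seq => m /hd /= ->.
have nz u : `|0 - u| < r%:C%C -> (restr y y1 (mpoly_of v \mPo S)).[u] != 0.
  by move=> /hr hu; rewrite horner_restr; apply: sv.
have := norm_horner_le 1 sz r0 nz; rewrite !horner_restr.
have -> : ev (fun i => y i + 1 * (y1 i - y i)) (mpoly_of v \mPo S) = ev y1 (mpoly_of v \mPo S).
  by rewrite !ev_mpoly_of; apply: eq_bigr => a _; congr (_ * _); apply: eq_bigr => k _;
    congr (_ ^+ _); apply: eq_bigr => s _; apply: eq_bigr => i _; rewrite mul1r addrC subrK.
have -> : ev (fun i => y i + 0 * (y1 i - y i)) (mpoly_of v \mPo S) = ev y (mpoly_of v \mPo S).
  by rewrite !ev_mpoly_of; apply: eq_bigr => a _; congr (_ * _); apply: eq_bigr => k _;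
    congr (_ ^+ _); apply: eq_bigr => s _; apply: eq_bigr => i _; rewrite mul0r addr0.
rewrite -/B => hB; have := close y; rewrite h0 subr0 => hy0.
have : `|V| <= e%:C%C * c y1 + B * (e%:C%C * c y).
  have -> : V = ev y1 (mpoly_of v \mPo S) - (ev y1 (mpoly_of v \mPo S) - V).
    by rewrite opprB addrC subrK.
  apply: le_trans (ler_normB _ _) _; rewrite addrC lerD ?close //.
  by apply: le_trans hB _; rewrite ler_wpM2l.
rewrite mulrCA -mulrDr -KE -XE -rmorphM lecR leNgt => /negP; apply.
rewrite /e mulrAC ltr_pdivrMr // mulrAC ltr_pdivrMr ?ltr_wpDl //; nra.
Qed.
End Generator.

(** * Euler operators on elementary symmetric polynomials *)

Section Theta.
Variables (A : comNzRingType) (n : nat).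
Implicit Types (p q : {mpoly A[n]}) (m : 'X_{1..n}).

Lemma scalD (w : 'X_{1..n} -> A) p q : scal w (p + q) = scal w p + scal w q.
Proof. by have := scal_is_linear w 1 p q; rewrite !scale1r. Qed.

Lemma scal0 (w : 'X_{1..n} -> A) : scal w 0 = 0.
Proof. by apply/mpolyP => m; rewrite mcoeff_scal mcoeff0 mulr0. Qed.

Lemma scalZ (w : 'X_{1..n} -> A) c p : scal w (c *: p) = c *: scal w p.
Proof. by have := scal_is_linear w c p 0; rewrite scal0 !addr0. Qed.

Lemma scal_sum (w : 'X_{1..n} -> A) (T : Type) (r : seq T) (P : pred T)
    (F : T -> {mpoly A[n]}) :
  scal w (\sum_(i <- r | P i) F i) = \sum_(i <- r | P i) scal w (F i).
Proof. by rewrite (big_morph _ (scalD w) (scal0 w)). Qed.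

Lemma scalX (w : 'X_{1..n} -> A) m : scal w 'X_[m] = w m *: 'X_[m].
Proof.
apply/mpolyP => k; rewrite mcoeff_scal mcoeffZ !mcoeffX.
by case: eqP => [->|]; rewrite ?mulr0.
Qed.

Lemma scal_derivation (w : 'X_{1..n} -> A) p q :
  (forall m1 m2, w (m1 + m2)%MM = w m1 + w m2) ->
  scal w (p * q) = scal w p * q + p * scal w q.
Proof.
move=> hw; elim/mpolyind: p => [|c m p _ _ IH]; first by rewrite !(mul0r, scal0) addr0.
have hX : scal w ('X_[m] * q) = scal w 'X_[m] * q + 'X_[m] * scal w q.
  elim/mpolyind: q {IH} => [|d k q _ _ IH]; first by rewrite !(mulr0, scal0) addr0.
  rewrite !(mulrDr, scalD) IH -!scalerAr -mpolyXD !scalZ !scalX hw mpolyXD.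
  by rewrite -!scalerAl -!scalerAr !scalerDl !scalerDr; ring.
rewrite !(mulrDl, scalD) IH -!scalerAl !scalZ hX scalerDr -!scalerAl.
by ring.
Qed.

Definition theta (j : 'I_n) p := scal (fun m => (m j)%:R) p.

Lemma thetaM j p q : theta j (p * q) = theta j p * q + p * theta j q.
Proof. by apply: scal_derivation => m1 m2; rewrite mnmDE natrD. Qed.

Lemma theta1 j : theta j 1 = 0.
Proof. by rewrite /theta -mpolyX0 scalX mnm0E scale0r. Qed.

Lemma theta_prod_seq (T : eqType) (r : seq T) (E : T -> {mpoly A[n]}) j : uniq r ->
  theta j (\prod_(i <- r) E i) =
  \sum_(i <- r) theta j (E i) * \prod_(k <- r | k != i) E k.
Proof.
elim: r => [|x r IH] /=; first by rewrite !big_nil theta1.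
move=> /andP[xr /IH {}IH]; rewrite !big_cons eqxx /= thetaM IH; congr (_ + _).
  congr (_ * _); rewrite [RHS]big_seq_cond [LHS]big_seq_cond; apply: eq_bigl => k.
  by rewrite andbT; case: (boolP (k \in r)) => // kr /=; apply: esym; apply: contraNneq xr => <-.
rewrite mulr_sumr !big_seq; apply: eq_bigr => i ir; rewrite big_cons.
by rewrite ifT; [ring | apply: contraNneq xr => ->].
Qed.

Lemma theta_prod (T : finType) (P : pred T) (E : T -> {mpoly A[n]}) j :
  theta j (\prod_(i | P i) E i) =
  \sum_(i | P i) theta j (E i) * \prod_(k | P k && (k != i)) E k.
Proof.
rewrite -big_filter theta_prod_seq ?filter_uniq ?index_enum_uniq // big_filter.
by apply: eq_bigr => i _; rewrite big_filter_cond.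
Qed.

Lemma scal_sqdeg p : scal (fun m => \sum_(j < n) (m j)%:R ^+ 2) p =
  \sum_(j < n) theta j (theta j p).
Proof.
apply/mpolyP => m; rewrite mcoeff_scal mcoeff_sum mulr_suml; apply: eq_bigr => j _.
by rewrite !mcoeff_scal mulrA expr2.
Qed.

(** Zero at negative indices, so that flows drawing too much from a vertex contribute nothing. *)
Definition es (a : int) : {mpoly A[n]} := if a is Posz k then mesym n A k else 0.

(** The monomials of an elementary symmetric polynomial are squarefree. *)
Lemma theta_idem j a : theta j (theta j (es a)) = theta j (es a).
Proof.
apply/mpolyP => m; rewrite !mcoeff_scal mulrA; case: a => k /=; last by rewrite mcoeff0 !mulr0.
rewrite mcoeff_mesym; case: (boolP (mechar k m)) => [/andP[_ /forallP/(_ j)]|]; last by rewrite !mulr0.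
by case: (m j) => [|[|]] //; rewrite ?mul0r ?mul1r.
Qed.

Lemma euler_es a : \sum_j theta j (es a) = a%:~R *: es a.
Proof.
case: a => k /=; last first.
  by rewrite scaler0 big1 // => j _; rewrite /theta scal0.
apply/mpolyP => m; rewrite mcoeff_sum mcoeffZ.
under eq_bigr do rewrite mcoeff_scal; rewrite -mulr_suml mcoeff_mesym.
case: (boolP (mechar k m)) => [/andP[/eqP <- _]|]; last by rewrite !mulr0.
by rewrite mdegE -pmulrn natr_sum.
Qed.

(* A monomial divisible by [X_j] in [e_(a+1)] comes from one not divisible by [X_j] in [e_a]. *)
Lemma theta_es_succ j a : theta j (es (a + 1)) = 'X_j * (es a - theta j (es a)).
Proof.
case: a => k; last first.
  rewrite /es /theta scal0 subrr mulr0; case: k => [|k].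
    by rewrite -[Negz 0 + 1]/(Posz 0) /= mesym0E; exact: theta1.
  have -> : Negz k.+1 + 1 = Negz k by rewrite !NegzE; lia.
  by rewrite scal0.
have -> : Posz k + 1 = Posz k.+1 by lia.
rewrite /= !mesymE /theta !scal_sum -sumrB mulr_sumr.
rewrite (bigID (fun h : {set 'I_n} => j \in h)) /= [X in _ + X]big1 ?addr0; last first.
  by move=> h /andP[_ jh]; rewrite scalX mnmE (negbTE jh) scale0r.
rewrite [RHS](bigID (fun h : {set 'I_n} => j \in h)) /= [X in _ = X + _]big1 ?add0r; last first.
  by move=> h /andP[_ jh]; rewrite scalX mnmE jh scale1r subrr mulr0.
rewrite (reindex_onto (fun h : {set 'I_n} => j |: h) (fun h => h :\ j)) /=; last first.
  by move=> h /andP[_ jh]; rewrite setD1K.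
have cond h : [&& #|j |: h| == k.+1, j \in j |: h & (j |: h) :\ j == h] =
              (#|h| == k) && (j \notin h).
  rewrite setU11; case: (boolP (j \in h)) => jh /=.
    rewrite !andbF; apply/negbTE/nandP; right.
    by apply: contraTneq jh => <-; rewrite setD11.
  by rewrite setU1K // eqxx !andbT cardsU1 jh add1n eqSS.
apply: eq_big => [h|h]; first by rewrite -andbA cond.
rewrite -andbA cond => /andP[_ jh]; rewrite !scalX !mnmE setU11 (negbTE jh) scale0r subr0 scale1r.
rewrite -mpolyXD; congr 'X_[_]; apply/mnmP => i; rewrite !mnmE in_setU1 eq_sym.
by case: eqP => [<-|]; rewrite ?(negbTE jh).
Qed.

Definition pairing a b : {mpoly A[n]} := \sum_j theta j (es a) * theta j (es b).

(** By [theta_es_succ] both sides equal the sum over j of [X_j (e_(a-1) theta_j e_b - e_b theta_j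
    e_(a-1))]; the terms with two thetas cancel. *)
Lemma pairing_step a b : pairing a b - pairing (a - 1) (b + 1) =
  a%:~R *: (es a * es b) - (b + 1)%:~R *: (es (a - 1) * es (b + 1)).
Proof.
rewrite !scalerAl -euler_es [in RHS]mulrC.
have -> : (b + 1)%:~R *: es (a - 1) * es (b + 1) = es (a - 1) * ((b + 1)%:~R *: es (b + 1)).
  by rewrite -scalerAl scalerAr.
rewrite -euler_es /pairing mulr_sumr mulr_sumr -!sumrB; apply: eq_bigr => j _.
have := theta_es_succ j (a - 1); rewrite subrK => ->; rewrite theta_es_succ; ring.
Qed.

Lemma es_neg a : a < 0 -> es a = 0. Proof. by case: a. Qed.

(** [pairing_step] telescopes, lowering a and raising b until the first index is non-positive and
    the pairing vanishes. *)
Lemma pairingE a b K : a <= K%:Z -> pairing a b = a%:~R *: (es a * es b) -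
  \sum_(k < K) (b - a + 2 * (k.+1)%:Z)%:~R *: (es (a - (k.+1)%:Z) * es (b + (k.+1)%:Z)).
Proof.
elim: K a b => [|K IH] a b aK.
  rewrite big_ord0 subr0; have [a0|a0] := ltrP a 0.
    rewrite es_neg // mul0r scaler0 /pairing big1 // => j _.
    by rewrite es_neg // /theta scal0 mul0r.
  have -> : a = 0 by lia.
  rewrite scale0r /pairing big1 // => j _.
  by rewrite /= mesym0E theta1 mul0r.
have h := pairing_step a b; have {}IH := IH (a - 1) (b + 1) ltac:(lia).
rewrite IH in h; move/eqP: h; rewrite subr_eq => /eqP ->.
rewrite big_ord_recl /=.
have -> : \sum_(i < K) (b - a + 2 * (bump 0 i).+1%:Z)%:~R *:
     (es (a - (bump 0 i).+1%:Z) * es (b + (bump 0 i).+1%:Z)) =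
   \sum_(k < K) (b + 1 - (a - 1) + 2 * (k.+1)%:Z)%:~R *:
     (es (a - 1 - (k.+1)%:Z) * es (b + 1 + (k.+1)%:Z)).
  apply: eq_bigr => i _; rewrite /bump leq0n; congr (_%:~R *: (es _ * es _)); lia.
have -> : (b - a + 2 * 1%:Z)%:~R = (b + 1)%:~R - (a - 1)%:~R :> A.
  by rewrite -rmorphB /=; congr (_%:~R); lia.
by rewrite scalerBl; ring.
Qed.
End Theta.

(** * Flows *)

Section FlowCombinatorics.
Variable m : nat.
Implicit Types (fl : edge m -> nat) (u v : edge m) (i l : 'I_m).

Definition tail u : 'I_m := (val u).1.
Definition head u : 'I_m := (val u).2.

Lemma tail_lt_head u : (tail u < head u)%N. Proof. exact: (valP u). Qed.

(** The flow constraint reads [2 a_i + b_i = 2m - exponent fl i]; with [a_i + b_i + c_i = m] this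
    also gives [exponent fl i = b_i + 2 c_i]. *)
Definition exponent fl i : int :=
  (2 * i.+1)%:Z - (\sum_(u | tail u == i) fl u)%:Z + (\sum_(u | head u == i) fl u)%:Z.

Definition height fl : nat := \sum_u fl u * (head u - tail u).

(** Summation by parts: a unit of flow along u adds [c (head u) - c (tail u)]. It is used with c
    constant, the vertex index, a step function, and the exponents themselves. *)
Lemma sum_exponent (c : 'I_m -> int) fl :
  \sum_i c i * (exponent fl i - (2 * i.+1)%:Z) =
  \sum_u (fl u)%:Z * (c (head u) - c (tail u)).
Proof.
have E (e : edge m -> 'I_m) :
    \sum_i c i * (\sum_(u | e u == i) fl u)%:Z = \sum_u (fl u)%:Z * c (e u).
  rewrite [RHS](partition_big e xpredT) //=; apply: eq_bigr => i _.
  rewrite -[Posz _]natz natr_sum mulr_sumr; apply: eq_bigr => u /eqP ->.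
  by rewrite natz mulrC.
under [RHS]eq_bigr do rewrite mulrBr.
rewrite sumrB -!E -sumrB; apply: eq_bigr => i _; rewrite /exponent; ring.
Qed.

Lemma sum_exponent1 fl : \sum_i exponent fl i = (m * m.+1)%:Z.
Proof.
have := sum_exponent (fun=> 1) fl.
rewrite [RHS]big1 => [|u _]; last by rewrite subrr mulr0.
under eq_bigr do rewrite mul1r.
move/eqP; rewrite sumrB subr_eq0 => /eqP ->; elim: (m) => [|k IH]; first by rewrite big_ord0.
by rewrite big_ord_recr /= IH; lia.
Qed.

Lemma sum_exponent_height fl :
  \sum_(i < m) (i.+1)%:Z * (exponent fl i - (2 * i.+1)%:Z) = (height fl)%:Z.
Proof.
rewrite (sum_exponent (fun i : 'I_m => (i.+1)%:Z)) /height -[RHS]natz natr_sum.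
apply: eq_bigr => u _; rewrite natz PoszM; congr (_ * _).
by have := tail_lt_head u; lia.
Qed.

Definition addflow fl u k : edge m -> nat := fun v => if v == u then (fl v + k)%N else fl v.

Lemma exponent_addflow fl u k i : exponent (addflow fl u k) i =
  exponent fl i + k%:Z * ((i == head u)%:Z - (i == tail u)%:Z).
Proof.
have E (e : edge m -> 'I_m) : (\sum_(v | e v == i) addflow fl u k v)%N =
    (\sum_(v | e v == i) fl v + k * (i == e u))%N.
  have [->|ne] := eqVneq i (e u); last first.
    rewrite muln0 addn0; apply: eq_bigr => v /eqP ev; rewrite /addflow; case: eqP => // vu.
    by rewrite -ev vu eqxx in ne.
  rewrite (bigD1 u) //= [in RHS](bigD1 u) //= muln1 /addflow eqxx addnAC; congr (_ + _)%N.
  congr (_ + _)%N; by apply: eq_bigr => v /andP[_ /negbTE ->].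
rewrite /exponent (E tail) (E head); lia.
Qed.

(** If all exponents were non-negative, [fl u] would be at most the height, hence at most m times
    the fixed total [m (m + 1)] of the exponents. *)
Lemma exponent_neg fl u : (m * (m * m.+1) < fl u)%N -> exists i, exponent fl i < 0.
Proof.
move=> hu; case: (boolP [exists i, exponent fl i < 0]) => [/existsP //|/existsPn h].
have pos i : 0 <= exponent fl i by have := h i; lia.
have : (fl u)%:Z <= (height fl)%:Z.
  rewrite lez_nat /height (bigD1 u) //=; have := tail_lt_head u; nia.
rewrite -sum_exponent_height leNgt => /negP; case.
apply: (@le_lt_trans _ _ (\sum_i m%:Z * exponent fl i)).
  apply: ler_sum => i _; have := pos i; have := ltn_ord i; nia.
by rewrite -mulr_sumr sum_exponent1; lia.
Qed.

Lemma sum_edges (V : nmodType) (X : 'I_m -> 'I_m -> V) :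
  \sum_(i < m) \sum_(l < m | (i < l)%N) X i l = \sum_u X (tail u) (head u).
Proof.
rewrite pair_big_dep /= (reindex_omap val (@insub _ _ (edge m))) /=.
  by apply: eq_bigl => u; rewrite (valP u) valK eqxx.
by move=> p hp; rewrite insubT.
Qed.

Lemma sum_pairs (V : nmodType) (X : 'I_m -> 'I_m -> V) :
  \sum_i \sum_(l | l != i) X i l = \sum_u (X (tail u) (head u) + X (head u) (tail u)).
Proof.
have T : \sum_(i < m) \sum_(l < m | (i < l)%N) X l i =
    \sum_(i < m) \sum_(l < m | (l < i)%N) X i l.
  by rewrite (exchange_big_dep xpredT).
rewrite big_split /= -sum_edges -(sum_edges (fun i l => X l i)) T -big_split /=.
apply: eq_bigr => i _; rewrite (bigID (fun l : 'I_m => (i < l)%N)) /=.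
congr (_ + _); apply: eq_bigl => l; rewrite -val_eqE /=; lia.
Qed.

Lemma sum_tail (V : nmodType) (c : 'I_m -> V) :
  \sum_u c (tail u) = \sum_(i < m) c i *+ (m - i.+1).
Proof.
rewrite -(sum_edges (fun i _ => c i)); apply: eq_bigr => i _.
by rewrite -(big_geq_mkord i.+1 m xpredT (fun=> c i)) sumr_const_nat.
Qed.
End FlowCombinatorics.

Section FlowForm.
Variables (R : realType) (m : nat).
Local Notation n := (2 * m)%N.
Implicit Types (fl : edge m -> nat) (u v : edge m) (i l : 'I_m).

Definition es_prod fl : {mpoly R[n]} := \prod_i es R n (exponent fl i).

Lemma es_prod0 fl : (exists i, exponent fl i < 0) -> es_prod fl = 0.
Proof. by case=> i hi; rewrite /es_prod (bigD1 i) //= es_neg // mul0r. Qed.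

Lemma es_prod_edge fl u : es_prod fl =
  es R n (exponent fl (tail u)) * es R n (exponent fl (head u)) *
  \prod_(i | (i != tail u) && (i != head u)) es R n (exponent fl i).
Proof.
rewrite /es_prod (bigD1 (tail u)) //= (bigD1 (head u)) /= ?mulrA //.
by rewrite -val_eqE /= gtn_eqF // tail_lt_head.
Qed.

Lemma es_prod_addflow fl u k : es_prod (addflow fl u k) =
  es R n (exponent fl (tail u) - k%:Z) * es R n (exponent fl (head u) + k%:Z) *
  \prod_(i | (i != tail u) && (i != head u)) es R n (exponent fl i).
Proof.
have ne : (tail u == head u) = false by rewrite -val_eqE /= ltn_eqF // tail_lt_head.
rewrite (es_prod_edge _ u) !exponent_addflow eqxx ne eq_sym ne eqxx.
congr (es _ _ _ * es _ _ _ * _); [lia|lia|].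
apply: eq_bigr => i /andP[/negbTE it /negbTE ih]; rewrite exponent_addflow it ih.
by congr (es _ _ _); lia.
Qed.

(** Leibniz's rule twice. Terms hitting one factor twice collapse, by [theta_idem] and Euler's
    identity, to the total exponent. Terms hitting two factors form pairings, two for each edge, and
    [pairingE] expands these by moving units from the tail index to the head index, that is, by
    adding flow on the edge. *)
Lemma sqdeg_es_prod fl K : (forall i, exponent fl i <= K%:Z) ->
  scal (@sqdeg R n) (es_prod fl) =
    ((m * m.+1)%:R + 2 * \sum_(i < m) (exponent fl i)%:~R *+ (m - i.+1)) *: es_prod fl
    - 2 *: \sum_u \sum_(k < K)
      (exponent fl (head u) - exponent fl (tail u) + 2 * (k.+1)%:Z)%:~R *:
      es_prod (addflow fl u k.+1).
Proof.
move=> hK; rewrite scal_sqdeg.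
pose E i := es R n (exponent fl i).
have theta2 j : theta j (theta j (es_prod fl)) =
    \sum_i theta j (E i) * \prod_(k | k != i) E k +
    \sum_i \sum_(l | l != i) theta j (E i) * theta j (E l) *
       \prod_(k | (k != i) && (k != l)) E k.
  rewrite /es_prod theta_prod /= {1}/theta scal_sum -big_split /=; apply: eq_bigr => i _.
  rewrite -/(theta j _) thetaM theta_idem theta_prod mulr_sumr; congr (_ + _).
  by apply: eq_bigr => l _; rewrite mulrA.
under eq_bigr do rewrite theta2.
rewrite big_split /= exchange_big /=.
have -> : \sum_i \sum_(j < n) theta j (E i) * \prod_(k | k != i) E k =
    (m * m.+1)%:R *: es_prod fl.
  have -> : (m * m.+1)%:R = (\sum_i exponent fl i)%:~R :> R by rewrite sum_exponent1.
  rewrite rmorph_sum /= scaler_suml; apply: eq_bigr => i _.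
  by rewrite -mulr_suml euler_es -scalerAl /es_prod [in RHS](bigD1 i).
rewrite scalerDl -addrA; congr (_ + _).
transitivity (\sum_i \sum_(l | l != i) pairing R n (exponent fl i) (exponent fl l) *
    \prod_(k | (k != i) && (k != l)) E k).
  rewrite exchange_big /=; apply: eq_bigr => i _; rewrite exchange_big /=.
  by apply: eq_bigr => l _; rewrite -mulr_suml.
rewrite sum_pairs.
have -> : \sum_(i < m) (exponent fl i)%:~R *+ (m - i.+1) =
   \sum_u (exponent fl (tail u))%:~R :> R by rewrite (sum_tail (fun i => (exponent fl i)%:~R)).
rewrite mulr_sumr scaler_suml scaler_sumr -sumrB; apply: eq_bigr => u _.
have -> : pairing R n (exponent fl (head u)) (exponent fl (tail u)) *
    \prod_(k | (k != head u) && (k != tail u)) E k =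
    pairing R n (exponent fl (tail u)) (exponent fl (head u)) *
    \prod_(k | (k != tail u) && (k != head u)) E k.
  congr (_ * _); last by apply: eq_bigl => k; rewrite andbC.
  by rewrite /pairing; apply: eq_bigr => j _; rewrite mulrC.
rewrite -mulr2n -scaler_nat -scalerA -scalerBr; congr (_ *: _).
rewrite (pairingE _ _ _ (hK (tail u))) mulrBl; congr (_ - _).
  by rewrite -scalerAl (es_prod_edge fl u).
rewrite mulr_suml; apply: eq_bigr => k _.
by rewrite -scalerAl es_prod_addflow.
Qed.
End FlowForm.

Section FlowStable.
Variables (R : realType) (m : nat).
Local Notation n := (2 * m)%N.
Local Notation w := (m * m.+1)%N.
Local Notation B := (m * (m * m.+1))%N.
Local Notation C := R[i].
Local Notation Im := complex.Im.
Local Notation ev y := (mmap (real_complex R) y).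
Local Notation S := [tuple mesym n R i.+1 | i < n].
(* By [exponent_neg] a flow with an entry above [B] has a negative exponent, so
   bounding the entries loses no term. *)
Let J : finType := {ffun edge m -> 'I_B.+1}.
Implicit Types (f : J) (u v : edge m).

Definition flow_of f : edge m -> nat := fun u => val (f u).
Local Notation expo f := (exponent (flow_of f)).

Lemma eq_exponent (fl1 fl2 : edge m -> nat) : fl1 =1 fl2 -> exponent fl1 =1 exponent fl2.
Proof.
by move=> e i; rewrite /exponent; congr (_ - Posz _ + Posz _); apply: eq_bigr => u _.
Qed.

Lemma eq_es_prod (fl1 fl2 : edge m -> nat) : fl1 =1 fl2 -> es_prod R fl1 = es_prod R fl2.
Proof. by move=> /eq_exponent e; apply: eq_bigr => i _; rewrite e. Qed.

Definition eh (a : int) : {mpoly R[n]} :=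
  match a with
  | Posz 0 => 1
  | Posz k.+1 => if insub k is Some i then 'X_i else 0
  | Negz _ => 0
  end.

Lemma eh_comp a : eh a \mPo S = es R n a.
Proof.
case: a => [[|k]|k] /=; [by rewrite comp_mpoly1 mesym0E| |by rewrite comp_mpoly0].
case: insubP => [i _ <-|]; last by rewrite -leqNgt comp_mpoly0 => h; rewrite mesym_geqnE.
by rewrite comp_mpolyXU -tnth_nth tnth_mktuple.
Qed.

Lemma eh_homog a : eh a \is (absz a).-homog for mnmwgt.
Proof.
case: a => [[|k]|k] /=; [exact: dhomog1| |exact: dhomog0].
case: insubP => [i _ <-|_]; last exact: dhomog0.
by rewrite dhomogX; apply/eqP; exact: mnmwgt1.
Qed.

Lemma eh_esq a : scal (@esq R n) (eh a) = (a ^+ 2)%:~R *: eh a.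
Proof.
have esq0 : esq R (0 : 'X_{1..n})%MM = 0 by rewrite /esq big1 // => k _; rewrite mnm0E.
case: a => [[|k]|k] /=; last by rewrite scal0 scaler0.
  by rewrite -mpolyX0 scalX esq0 expr0n.
case: insubP => [i _ <-|_]; last by rewrite scal0 scaler0.
rewrite scalX /esq (bigD1 i) //= mnm1E eqxx mulr1n big1 ?addr0; last first.
  by move=> l li; rewrite mnm1E eq_sym (negbTE li).
by rewrite rmorphXn.
Qed.

Definition eprod f : {mpoly R[n]} := \prod_i eh (expo f i).

Lemma eprod_comp f : eprod f \mPo S = es_prod R (flow_of f).
Proof.
by rewrite /eprod rmorph_prod; apply: eq_bigr => i _; exact: eh_comp.
Qed.

Lemma eprod_homog f : eprod f \is w.-homog for mnmwgt.
Proof.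
have [/existsP [i hi]|/existsPn pos] := boolP [exists i, expo f i < 0].
  rewrite /eprod (bigD1 i) //=; case: (expo f i) hi => // k _.
  by rewrite mul0r dhomog0.
have -> : w = (\sum_i absz (expo f i))%N.
  suff : (\sum_i absz (expo f i))%N%:Z = w%:Z by case.
  rewrite -(sum_exponent1 (flow_of f)) -[LHS]natz natr_sum; apply: eq_bigr => i _.
  by rewrite natz; have := pos i; lia.
rewrite /eprod; elim/big_ind2: _ => [|p d q e hp hq|i _]; first exact: dhomog1.
  exact: dhomogM.
exact: eh_homog.
Qed.

Lemma eprod_esq f : scal (@esq R n) (eprod f) = (\sum_i expo f i ^+ 2)%:~R *: eprod f.
Proof.
have add m1 m2 : esq R (m1 + m2 : 'X_{1..n})%MM = esq R m1 + esq R m2.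
  by rewrite /esq -big_split /=; apply: eq_bigr => k _; rewrite mnmDE mulrnDr.
rewrite /eprod; elim/big_rec2: _ => [|i p s _ IH].
  by rewrite -mpolyX0 scalX /esq big1 // => k _; rewrite mnm0E.
by rewrite scal_derivation // IH eh_esq rmorphD scalerDl -scalerAl -scalerAr.
Qed.

Definition upd_flow f u (k : 'I_B.+1) : J := [ffun v => if v == u then k else f v].
Definition raises f u f' := (f u < f' u)%N && [forall v, (v != u) ==> (f v == f' v)].

Lemma raisesP f u f' : reflect ((f u < f' u)%N /\ f' = upd_flow f u (f' u)) (raises f u f').
Proof.
apply: (iffP andP) => [[h /forallP e]|[h e]]; split=> //.
  apply/ffunP => v; rewrite ffunE; case: eqP => [->//|/eqP vu].
  by have := e v; rewrite vu => /eqP ->.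
by apply/forallP => v; apply/implyP => /negbTE vu; rewrite e ffunE vu.
Qed.

Lemma sum_raises (V : nmodType) f u (G : J -> V) :
  \sum_(f' | raises f u f') G f' = \sum_(k : 'I_B.+1 | (f u < k)%N) G (upd_flow f u k).
Proof.
rewrite (reindex_onto (upd_flow f u) (fun f' : J => f' u)) /=; last first.
  by move=> f' /raisesP[_ <-].
apply: eq_bigl => k; rewrite ffunE eqxx eqxx andbT.
apply/raisesP/idP => [[]|h]; rewrite ffunE eqxx //.
Qed.

Lemma sum_raised_to (V : nmodType) f' u (G : J -> V) :
  \sum_(f | raises f u f') G f = \sum_(k : 'I_B.+1 | (k < f' u)%N) G (upd_flow f' u k).
Proof.
have sym f : raises f u f' -> f = upd_flow f' u (f u).
  move=> /raisesP[_ e]; apply/ffunP => v; rewrite ffunE; case: eqP => [->//|/eqP vu].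
  by rewrite e ffunE (negbTE vu).
rewrite (reindex_onto (upd_flow f' u) (fun f : J => f u)) /=; last first.
  by move=> f /sym <-.
apply: eq_bigl => k; rewrite ffunE eqxx eqxx andbT.
apply/raisesP/idP => [[]|h]; rewrite ffunE eqxx //; split=> //.
by apply/ffunP => v; rewrite !ffunE; case: eqP => // ->.
Qed.

Lemma flow_of_upd f u (k : 'I_B.+1) : (f u <= k)%N ->
  flow_of (upd_flow f u k) =1 addflow (flow_of f) u (k - f u).
Proof.
move=> h v; rewrite /flow_of /addflow ffunE; by case: eqP => // ->; rewrite subnKC.
Qed.

Definition diag_rate f : R := - (\sum_i expo f i * (expo f i - (2 * i.+1)%:Z))%:~R.
(** The coefficient [b - a + 2 k] of [pairingE] is the exponent difference after k units have moved,
    so the rate depends on the target flow alone. *)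
Definition rate f u : R := (2 * (expo f (head u) - expo f (tail u)))%:~R.
(* The generator acts on products of elementary symmetric polynomials, which
   distinct flows may share; on flows themselves its left kernel is explicit
   (see [generator_ker]). *)
Definition generator f f' : R :=
  (f == f')%:R * diag_rate f + \sum_u (raises f u f')%:R * rate f' u.

Let f0 : J := [ffun=> ord0].

(** From [a (a - 2i) = (a - 2i)^2 + 2i (a - 2i)], the last terms summing to twice the height; the
    entry is thus negative off the zero flow. *)
Lemma diag_rateE f : diag_rate f =
  - (\sum_i (expo f i - (2 * i.+1)%:Z) ^+ 2 + 2 * (height (flow_of f))%:Z)%:~R.
Proof.
rewrite /diag_rate -sum_exponent_height mulr_sumr -big_split /=; congr (- _%:~R).
by apply: eq_bigr => i _; ring.
Qed.

Lemma generator_diag f : f != f0 -> generator f f <= -1.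
Proof.
move=> nf; rewrite /generator eqxx mul1r big1 ?addr0; last first.
  by move=> u _; rewrite /raises ltnn mul0r.
rewrite diag_rateE lerN2 -[1]/(1%:~R) ler_int.
have h : (0 < height (flow_of f))%N.
  rewrite lt0n; apply: contraNneq nf => /eqP; rewrite /height sum_nat_eq0 => /forallP h0.
  apply/eqP/ffunP => u; rewrite ffunE; apply: val_inj => /=.
  have := h0 u; rewrite /= muln_eq0 subn_eq0 leqNgt tail_lt_head orbF => /eqP //.
have : 0 <= \sum_i (expo f i - (2 * i.+1)%:Z) ^+ 2 by apply: sumr_ge0 => i _; exact: sqr_ge0.
lia.
Qed.

Lemma generator_up f f' : generator f f' != 0 -> f != f' ->
  (height (flow_of f) < height (flow_of f'))%N.
Proof.
move=> g0 /negbTE ff; have [u hu] : exists u, raises f u f'.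
  apply/existsP; apply: contraNT g0 => /existsPn h.
  rewrite /generator ff mul0r add0r big1 // => u _.
  by rewrite (negbTE (h u)) mul0r.
have [lt e] := raisesP _ _ _ hu; rewrite /height (bigD1 u) //= [ltnRHS](bigD1 u) //=.
rewrite -addSn leq_add //.
  by rewrite ltn_mul2r subn_gt0 tail_lt_head.
rewrite leq_eqVlt; apply/orP; left; apply/eqP; apply: eq_bigr => v vu.
by rewrite /flow_of e ffunE (negbTE vu).
Qed.

Definition gweight f : R := \prod_u ((f u).+1)%:R.

Lemma sum_below F : (F <= B.+1)%N ->
  2 * \sum_(k : 'I_B.+1 | (k < F)%N) (k.+1)%:R = (F * F.+1)%:R :> R.
Proof.
move=> FB; rewrite -(big_ord_widen _ (fun k => (k.+1)%:R : R) FB).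
elim: F {FB} => [|F IH]; first by rewrite big_ord0 mulr0.
by rewrite big_ord_recr mulrDr IH /= -[2]/(2%:R) -natrM -natrD; congr _%:R; lia.
Qed.

(** The flows raised to f' along u have a smaller value k at u and share the rate [rate f' u]. Since
    [2 * sum_(k < f'_u) (k + 1) = f'_u (f'_u + 1)], their weights recombine to [gweight f'] times
    [f'_u] times the exponent difference across u. Summed over u this is minus the diagonal entry,
    by [sum_exponent] with c the exponents. *)
Lemma generator_ker f' : \sum_f gweight f * generator f f' = 0.
Proof.
rewrite /generator; under eq_bigr do rewrite mulrDr.
rewrite big_split /= (bigD1 f') //= eqxx mul1r big1 ?addr0; last first.
  by move=> f /negbTE ->; rewrite mul0r mulr0.
have -> : \sum_f gweight f * \sum_u (raises f u f')%:R * rate f' u =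
    \sum_u rate f' u * \sum_(k : 'I_B.+1 | (k < f' u)%N) gweight (upd_flow f' u k).
  under eq_bigr do rewrite mulr_sumr.
  rewrite exchange_big /=; apply: eq_bigr => u _; rewrite -sum_raised_to mulr_sumr.
  rewrite [RHS]big_mkcond /=; apply: eq_bigr => f _.
  by case: raises; rewrite ?(mul0r, mulr0) // mul1r mulrC.
have e u : rate f' u * \sum_(k : 'I_B.+1 | (k < f' u)%N) gweight (upd_flow f' u k) =
    gweight f' * ((f' u)%:Z * (expo f' (head u) - expo f' (tail u)))%:~R.
  have -> : \sum_(k : 'I_B.+1 | (k < f' u)%N) gweight (upd_flow f' u k) =
     (\sum_(k : 'I_B.+1 | (k < f' u)%N) (k.+1)%:R) * \prod_(v | v != u) ((f' v).+1)%:R.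
    rewrite mulr_suml; apply: eq_bigr => k _; rewrite /gweight (bigD1 u) //= ffunE eqxx.
    by congr (_ * _); apply: eq_bigr => v /negbTE vu; rewrite ffunE vu.
  rewrite /rate intrM mulrAC mulrA -[2%:~R]/(2 : R) sum_below; last by rewrite ltnW.
  by rewrite /gweight [in RHS](bigD1 u) //= intrM natrM -pmulrn; ring.
rewrite (eq_bigr _ (fun u _ => e u)) -mulr_sumr -mulrDr.
rewrite /diag_rate -rmorph_sum /= -rmorphN -rmorphD /=.
have -> : \sum_i expo f' i * (expo f' i - (2 * i.+1)%:Z) =
    \sum_u (f' u)%:Z * (expo f' (head u) - expo f' (tail u)).
  exact: (sum_exponent (expo f') (flow_of f')).
by rewrite addNr mulr0.
Qed.

(** This is [(2m + 1) sum_i a_i]: it turns the diagonal [- sum a_i^2 - sum a_i - 2 sum a_i (m - i)]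
    of the two substitutions into [sum a_i (2i - a_i)], which is zero at the zero flow. *)
Definition flow_kappa : R := ((2 * m).+1 * w)%:R.

Lemma generator_eprod f : - scal (@sqdeg R n) (eprod f \mPo S) +
  ((flow_kappa *: eprod f - scal (@esq R n) (eprod f)) \mPo S) =
  (\sum_f' generator f f' *: eprod f') \mPo S.
Proof.
rewrite eprod_esq -scalerBl comp_mpolyZ eprod_comp comp_sum.
pose K := (B + \sum_i absz (expo f i))%N.
have hK i : expo f i <= K%:Z.
  by rewrite /K (bigD1 i) //=; lia.
rewrite (sqdeg_es_prod R hK).
pose T u j := (expo f (head u) - expo f (tail u) + 2 * j%:Z)%:~R *:
   es_prod R (addflow (flow_of f) u j).
(* With more than [B - f u] units added, the entry at u exceeds [B] and the product vanishes by
   [exponent_neg]; K is at least [B], so the cut falls inside the range. *)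
have -> : \sum_u \sum_(k < K) (expo f (head u) - expo f (tail u) + 2 * (k.+1)%:Z)%:~R *:
      es_prod R (addflow (flow_of f) u k.+1) = \sum_u \sum_(1 <= j < B.+1 - f u) T u j.
  apply: eq_bigr => u _; have fu := ltn_ord (f u).
  rewrite -(big_mkord xpredT (fun k => T u k.+1)) -(big_add1 _ _ 0%N K.+1 xpredT (T u)).
  have h1 : (1 <= B.+1 - f u)%N by lia.
  have h2 : (B.+1 - f u <= K.+1)%N by rewrite /K; lia.
  rewrite (big_cat_nat h1 h2) /=.
  rewrite [X in _ + X]big_nat [X in _ + X]big1 ?addr0 // => j /andP[hj _].
  rewrite /T es_prod0 ?scaler0 //; apply: (@exponent_neg _ _ u).
  by rewrite /addflow eqxx /flow_of /= -leq_subLR.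
have -> : \sum_f' ((generator f f' *: eprod f') \mPo S) =
    diag_rate f *: es_prod R (flow_of f) + 2 *: \sum_u \sum_(1 <= j < B.+1 - f u) T u j.
  under eq_bigr do rewrite comp_mpolyZ eprod_comp /generator scalerDl.
  rewrite big_split /= (bigD1 f) //= eqxx mul1r big1 ?addr0; last first.
    by move=> f'; rewrite eq_sym => /negbTE ->; rewrite mul0r scale0r.
  congr (_ + _); under eq_bigr do rewrite scaler_suml.
  rewrite exchange_big /= scaler_sumr; apply: eq_bigr => u _.
  transitivity (\sum_(f' | raises f u f') rate f' u *: es_prod R (flow_of f')).
    rewrite [RHS]big_mkcond /=; apply: eq_bigr => f' _.
    by case: raises; rewrite ?(mul1r, mul0r, scale0r).
  rewrite sum_raises.
  transitivity (\sum_(k : 'I_B.+1 | (f u < k)%N) 2 *: T u (k - f u)%N).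
    apply: eq_bigr => k fk; have h := flow_of_upd (ltnW fk).
    have ne : (tail u == head u) = false by rewrite -val_eqE /= ltn_eqF // tail_lt_head.
    rewrite (eq_es_prod h) /T scalerA /rate !(eq_exponent h) !exponent_addflow !eqxx ne eq_sym ne.
    congr (_ *: _); rewrite intrM; congr (_ * _%:~R); lia.
  rewrite -(big_geq_mkord (f u).+1 B.+1 xpredT (fun k => 2 *: T u (k - f u)%N)).
  rewrite -[(f u).+1]add1n big_addn -scaler_sumr; congr (_ *: _).
  by apply: eq_bigr => j _; rewrite addnK.
rewrite opprB -addrA -scaleNr -scalerDl addrC; congr (_ *: _ + _).
have -> : \sum_(i < m) (expo f i)%:~R *+ (m - i.+1) =
    (\sum_(i < m) (expo f i) *+ (m - i.+1))%:~R :> R.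
  by rewrite rmorph_sum /=; apply: eq_bigr => i _; rewrite rmorphMn.
have -> : flow_kappa = ((2 * m).+1%:Z * \sum_i expo f i)%:~R by rewrite sum_exponent1.
have -> : (w%:R : R) = (\sum_i expo f i)%:~R by rewrite sum_exponent1.
rewrite /diag_rate -[2]/(2%:~R) -!(rmorphM, rmorphD, rmorphN) /=; congr (_%:~R).
rewrite !mulr_sumr -!sumrN -!big_split /=.
rewrite -[X in X + _]sumrN -big_split /=; apply: eq_bigr => i _.
have im := ltn_ord i.
have e1 : (m - i.+1)%:Z = m%:Z - i%:Z - 1 by lia.
have -> : (2 * i.+1)%:Z = 2 * i%:Z + 2 by lia.
have -> : (2 * m).+1%:Z = 2 * m%:Z + 1 by lia.
rewrite -[expo f i *+ _]mulr_natr (natz (m - i.+1)) e1; ring.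
Qed.

Lemma exponent0 i : expo f0 i = (2 * i.+1)%:Z.
Proof.
rewrite /exponent !big1 ?subr0 ?addr0 // => u _; by rewrite /flow_of ffunE.
Qed.

Lemma ev_es y a : ev y (es R n a) = if a is Posz k then esum y k else 0.
Proof. by case: a => k /=; [exact: ev_mesym | rewrite mmap0]. Qed.

Lemma ev_es_prod0 y : ev y (es_prod R (flow_of f0)) = \prod_(i < m) esum y (2 * i.+1).
Proof.
by rewrite /es_prod rmorph_prod; apply: eq_bigr => i _; rewrite exponent0 /= ev_mesym.
Qed.

Lemma stable_eprod0 : stable (eprod f0 \mPo S).
Proof.
move=> y hy; rewrite eprod_comp ev_es_prod0; apply/prodf_neq0 => i _.
by apply: esum_neq0 => //; rewrite leq_mul2l ltn_ord orbT.
Qed.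

Definition flow_form : {mpoly R[n]} := \sum_f gweight f *: es_prod R (flow_of f).

Lemma esum_const k : esum (fun _ : 'I_n => 'i%C : C) k = 'C(n, k)%:R * 'i%C ^+ k.
Proof.
rewrite /esum (eq_bigr (fun=> 'i%C ^+ k)) => [|h /eqP <-]; last by rewrite prodr_const.
rewrite sumr_const mulr_natl; congr (_ *+ _).
by rewrite -[X in 'C(X, _)]card_ord -card_draws cardsE.
Qed.

(** When all variables equal the imaginary unit, every nonzero term is a positive multiple of the
    same power of it, so nothing cancels and the zero flow contributes. This is the nonzero value
    that Hurwitz's argument requires. *)
Lemma flow_form_const : exists2 N : nat, (0 < N)%N &
  ev (fun=> 'i%C) flow_form = N%:R * 'i%C ^+ w.
Proof.
pose nb f := (\prod_i if expo f i is Posz k then 'C(n, k) else 0)%N.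
exists (\sum_(f : J) (\prod_u (f u).+1) * nb f)%N.
  rewrite (bigD1 f0) //= addn_gt0; apply/orP; left; rewrite muln_gt0.
  rewrite !prodn_gt0 // => i; rewrite exponent0 bin_gt0 leq_mul2l.
  by rewrite ltn_ord orbT.
rewrite /flow_form raddf_sum /= natr_sum mulr_suml; apply: eq_bigr => f _.
rewrite mmapZ natrM /gweight rmorph_prod natr_prod -mulrA; congr (_ * _).
  by apply: eq_bigr => u _; rewrite /= rmorph_nat.
have [/existsP [i hi]|/existsPn pos] := boolP [exists i, expo f i < 0].
  rewrite es_prod0 ?mmap0; last by exists i.
  rewrite /nb (bigD1 i) //=; by case: (expo f i) hi => // k _; rewrite mul0n mul0r.
have -> : w = (\sum_i absz (expo f i))%N.
  suff : (\sum_i absz (expo f i))%N%:Z = w%:Z by case.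
  rewrite -(sum_exponent1 (flow_of f)) -[LHS]natz natr_sum; apply: eq_bigr => i _.
  by rewrite natz; have := pos i; lia.
rewrite /es_prod rmorph_prod /nb natr_prod -prodrXr -big_split /=; apply: eq_bigr => i _.
rewrite ev_es; have := pos i; case: (expo f i) => // k _.
exact: esum_const.
Qed.

Theorem flow_form_stable : stable flow_form.
Proof.
move=> y hy; have [N N0 eN] := flow_form_const.
have kap0 : 0 <= flow_kappa by rewrite /flow_kappa ler0n.
have h0 : height (flow_of f0) = 0%N.
  by rewrite /height big1 // => u _; rewrite /flow_of ffunE.
have g0 : gweight f0 = 1 by rewrite /gweight big1 // => u _; rewrite ffunE.
have E : limit_form eprod gweight \mPo S = flow_form.
  rewrite /limit_form comp_sum; apply: eq_bigr => f _.
  by rewrite comp_mpolyZ eprod_comp.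
have hi : upper (fun _ : 'I_n => 'i%C : C) by move=> i /=; exact: ltr01.
have := stable_limit (h := fun f => height (flow_of f)) eprod_homog generator_diag generator_up h0 g0
  generator_ker generator_eprod kap0 stable_eprod0 hy hi.
rewrite E eN; apply; rewrite mulf_neq0 ?pnatr_eq0 -?lt0n // expf_neq0 //.
by rewrite eq_complex /= oner_eq0 andbF.
Qed.
End FlowStable.

(** * The flow form and the gamma polynomial *)

Section Trinomial.
Variable m : nat.
Definition triple : finType := ('I_m.+1 * 'I_m.+1 * 'I_m.+1)%type.
Implicit Type t : triple.
Definition trinom t : nat := (m`! %/ (t.1.1`! * t.1.2`! * t.2`!))%N.

Lemma trinomE t : (t.1.1 + t.1.2 + t.2 = m)%N ->
  trinom t = ('C(m, t.2) * 'C(m - t.2, t.1.2))%N.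
Proof.
case: t => [[a b] c] /= abc; rewrite /trinom /=.
have e : ('C(m, c) * 'C(m - c, b) * (a`! * b`! * c`!) = m`!)%N.
  have cm : (c <= m)%N by lia.
  have bm : (b <= m - c)%N by lia.
  rewrite -(bin_fact cm) -(bin_fact bm).
  have -> : (m - c - b = a)%N by lia.
  ring.
by rewrite -e mulnK // !muln_gt0 !fact_gt0.
Qed.

Lemma trinom_gt0 t : (t.1.1 + t.1.2 + t.2 = m)%N -> (0 < trinom t)%N.
Proof.
move=> h; rewrite trinomE // muln_gt0 !bin_gt0; case: t h => [[a b] c] /= h.
by apply/andP; split; lia.
Qed.

Lemma trinomial_expansion (A : comNzRingType) (x y z : A) : (x + y + z) ^+ m =
  \sum_(t : triple | (t.1.1 + t.1.2 + t.2 == m)%N)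
    (x ^+ t.1.1 * y ^+ t.1.2 * z ^+ t.2) *+ trinom t.
Proof.
rewrite exprDn (eq_bigr (fun c : 'I_m.+1 => \sum_(b : 'I_m.+1 | (b + c <= m)%N)
   (x ^+ (m - c - b) * y ^+ b * z ^+ c) *+ ('C(m, c) * 'C(m - c, b)))); last first.
  move=> c _; rewrite exprDn mulr_suml -sumrMnl.
  rewrite (big_ord_widen_cond m.+1 xpredT
    (fun b => x ^+ (m - c - b) * y ^+ b *+ 'C(m - c, b) * z ^+ c *+ 'C(m, c))); last first.
    by rewrite ltnS leq_subr.
  apply: eq_big => [b|b _]; first by rewrite ltnS; have := ltn_ord c; lia.
  by rewrite mulrnAl -mulrnA mulnC.
pose G (a b c : nat) : A := (x ^+ a * y ^+ b * z ^+ c) *+ (m`! %/ (a`! * b`! * c`!)).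
transitivity (\sum_(c < m.+1) \sum_(b < m.+1) \sum_(a < m.+1 | (a + b + c == m)%N) G a b c).
  apply: eq_bigr => c _; rewrite [LHS]big_mkcond /=; apply: eq_bigr => b _.
  case: ifP => h; last first.
    by rewrite big_pred0 // => a; apply/negP => /eqP; lia.
  have am : (m - c - b < m.+1)%N by lia.
  rewrite (big_pred1 (Ordinal am)) => [|a]; last by rewrite /= -val_eqE /=; lia.
  rewrite /G /=; congr (_ *+ _).
  by rewrite -(@trinomE (Ordinal am, b, c)) //=; lia.
under eq_bigr do under eq_bigr do rewrite big_mkcond /=.
rewrite exchange_big /=; under eq_bigr do rewrite exchange_big /=.
rewrite exchange_big /= [RHS]big_mkcond /=.
rewrite -(pair_bigA _ (fun (p : 'I_m.+1 * 'I_m.+1) (c : 'I_m.+1) => if (p.1 + p.2 + c == m)%N then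
  (x ^+ p.1 * y ^+ p.2 * z ^+ c) *+ trinom (p, c) else 0)) /=.
rewrite -(pair_bigA _ (fun a b : 'I_m.+1 => \sum_(c < m.+1) if (a + b + c == m)%N then
  (x ^+ a * y ^+ b * z ^+ c) *+ trinom (a, b, c) else 0)) /=.
by apply: eq_bigr => a _; apply: eq_bigr => b _.
Qed.

Lemma coef_trinomial (A : comNzRingType) (z : A) k :
  (('X^2 + 'X + z%:P) ^+ m)`_k =
  \sum_(t : triple | (t.1.1 + t.1.2 + t.2 == m)%N && (2 * t.1.1 + t.1.2 == k)%N)
    z ^+ t.2 *+ trinom t.
Proof.
rewrite trinomial_expansion coef_sum big_mkcondr /=; apply: eq_bigr => t _.
rewrite coefMn -exprM -exprD -rmorphXn /= coefMC coefXn.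
by rewrite eq_sym; case: ifP => _; rewrite ?mul1r // mul0r mul0rn.
Qed.
End Trinomial.

Section Bounds.
Variable m : nat.

Lemma Nexp_gexp : (2 * (Nexp m + gexp m) = m * m.+1)%N.
Proof.
rewrite /Nexp /gexp -(odd_double_half m); set k := m./2.
by case: (odd m); rewrite -?mul2n /=; lia.
Qed.

Lemma sum_tail_index : (\sum_(i < m) (2 * i.+1 - m) = Nexp m)%N.
Proof.
have rev k : (\sum_(i < k) (2 * i.+1 - k) = \sum_(i < k) (k - 2 * i))%N.
  rewrite (reindex_inj rev_ord_inj) /=; apply: eq_bigr => i _; have := ltn_ord i; lia.
rewrite rev /Nexp; move: (m).
suff h k : (\sum_(i < k) (k - 2 * i) = (k.+1 ^ 2) %/ 4)%N /\
    (\sum_(i < k.+1) (k.+1 - 2 * i) = (k.+2 ^ 2) %/ 4)%N by move=> k; case: (h k).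
elim: k => [|k [IH1 IH2]]; first by rewrite big_ord0 big_ord_recl big_ord0.
split=> //; rewrite big_ord_recl /= big_ord_recr /=.
have -> : (\sum_(i < k) (k.+2 - 2 * bump 0 i) = \sum_(i < k) (k - 2 * i))%N.
  by apply: eq_bigr => i _; rewrite /bump /=; lia.
by rewrite IH1 /bump /=; lia.
Qed.

Variables (fl : edge m -> nat) (t : 'I_m -> triple m).
Hypothesis t_sum : forall i, ((t i).1.1 + (t i).1.2 + (t i).2 = m)%N.
Hypothesis t_flow : forall i,
  (2 * (t i).1.1 + (t i).1.2)%:Z = (2 * m)%:Z - exponent fl i.

(** [2 c_i] is at most [exponent fl i = b_i + 2 c_i], and the exponents sum to [m (m + 1)]. *)
Lemma sum_c_le : (\sum_i (t i).2 <= Nexp m + gexp m)%N.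
Proof.
rewrite -(leq_pmul2l (isT : 0 < 2)%N) Nexp_gexp -lez_nat -(sum_exponent1 fl).
rewrite PoszM -[X in _ * X]natz natr_sum mulr_sumr; apply: ler_sum => i _.
have := t_sum i; have := t_flow i; rewrite natz; lia.
Qed.

(** [(t i).2] is at least 0 and at least [exponent fl i - m]. Over the vertices with [2i > m] the
    exponents sum to at least the corresponding [2i], because flow runs towards larger indices,
    along which the step function [c] does not decrease. *)
Lemma sum_c_ge : (Nexp m <= \sum_i (t i).2)%N.
Proof.
pose c (i : 'I_m) : int := (m < 2 * i.+1)%N%:Z.
have h : 0 <= \sum_i c i * (exponent fl i - (2 * i.+1)%:Z).
  rewrite sum_exponent; apply: sumr_ge0 => u _; apply: mulr_ge0 => //.
  have := tail_lt_head u; rewrite /c; lia.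
rewrite -sum_tail_index -lez_nat -[leRHS]natz natr_sum -[leLHS]natz natr_sum.
rewrite -subr_ge0 -sumrB; apply: le_trans h _; apply: ler_sum => i _.
have := t_sum i; have := t_flow i; rewrite !natz /c.
by case: (ltnP m (2 * i.+1)); lia.
Qed.
End Bounds.

Section GammaLink.
Variables (R : realType) (m : nat).
Local Notation n := (2 * m)%N.
Local Notation B := (m * (m * m.+1))%N.
Local Notation C := R[i].
Local Notation ev y := (mmap (real_complex R) y).
Let J : finType := {ffun edge m -> 'I_B.+1}.
Let T : finType := (J * {ffun 'I_m -> triple m})%type.
Implicit Types (x : T) (f : J).

Definition balanced f i (t : triple m) : bool :=
  (t.1.1 + t.1.2 + t.2 == m)%N &&
  ((2 * t.1.1 + t.1.2)%:Z == (2 * m)%:Z - exponent (flow_of f) i).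

Definition balanced_all x : bool := [forall i, balanced x.1 i (x.2 i)].

Definition decode x : arrays m :=
  ([ffun u => val (x.1 u)], [ffun i => val (x.2 i).1.1],
   [ffun i => val (x.2 i).1.2], [ffun i => val (x.2 i).2]).

Lemma decode_inj : injective decode.
Proof.
move=> [f t] [f' t'] [/ffunP ef /ffunP ea /ffunP eb /ffunP ec]; congr (_, _).
  by apply/ffunP => u; apply: val_inj; have := ef u; rewrite !ffunE.
apply/ffunP => i; move: (ea i) (eb i) (ec i); rewrite !ffunE.
case: (t i) (t' i) => [[a b] c] [[a' b'] c'] /= e1 e2 e3.
by congr (_, _, _); apply: val_inj.
Qed.

Lemma exponent_arrays (x : arrays m) i : exponent (arr_f x) i =
  (2 * i.+1)%:Z - (outflow x i)%:Z + (inflow x i)%:Z.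
Proof. by []. Qed.

Lemma admissible_decode x j : admissible (decode x) j <->
  balanced_all x && (\sum_i (x.2 i).2 == Nexp m + j)%N.
Proof.
have ee i : exponent (arr_f (decode x)) i = exponent (flow_of x.1) i.
  by apply: eq_exponent => u; rewrite /arr_f /= ffunE.
have hi (i : 'I_m) : (2 * (m - i.+1))%:Z = (2 * m)%:Z - (2 * i.+1)%:Z by have := ltn_ord i; lia.
split=> [[h1 h2 h3]|/andP[/forallP h1 /eqP h2]].
  apply/andP; split; last first.
    by apply/eqP; rewrite -h3; apply: eq_bigr => i _; rewrite /arr_c /= ffunE.
  apply/forallP => i; apply/andP; split.
    by have := h1 i; rewrite /arr_a /arr_b /arr_c /= !ffunE => /eqP.
  have := h2 i; rewrite -ee exponent_arrays hi /arr_a /arr_b /= !ffunE => ->.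
  by apply/eqP; ring.
split=> [i|i|].
- by have /andP[/eqP] := h1 i; rewrite /arr_a /arr_b /arr_c /= !ffunE.
- have /andP[_ /eqP] := h1 i; rewrite -ee exponent_arrays hi /arr_a /arr_b /= !ffunE => ->.
  by ring.
- by rewrite -h2; apply: eq_bigr => i _; rewrite /arr_c /= ffunE.
Qed.

Lemma admissible_in_decode (x : arrays m) j : admissible x j -> exists z, decode z = x.
Proof.
case=> h1 h2 h3.
have fB u : (arr_f x u <= B)%N.
  rewrite leqNgt; apply/negP => hu; have [i0] := exponent_neg hu.
  rewrite exponent_arrays; have := h1 i0; have := h2 i0; have := ltn_ord i0; lia.
have aB i : (arr_a x i < m.+1)%N by have := h1 i; lia.
have bB i : (arr_b x i < m.+1)%N by have := h1 i; lia.
have cB i : (arr_c x i < m.+1)%N by have := h1 i; lia.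
exists ([ffun u => Ordinal (fB u : arr_f x u < B.+1)%N],
        [ffun i => (Ordinal (aB i), Ordinal (bB i), Ordinal (cB i))]).
case: x {h1 h2 h3} fB aB bB cB => [[[f a] b] c] fB aB bB cB.
by rewrite /decode; congr (_, _, _, _); apply/ffunP => i; rewrite !ffunE.
Qed.

Lemma weight_decode x : weight (decode x) =
  ((\prod_u (x.1 u).+1) * \prod_i trinom (x.2 i))%N.
Proof.
rewrite /weight; congr (_ * _)%N; apply: eq_bigr => u _.
  by rewrite /arr_f /= ffunE.
by rewrite /arr_a /arr_b /arr_c /= !ffunE.
Qed.

Lemma gammaE j : gamma m j =
  (\sum_(x : T | balanced_all x && (\sum_i (x.2 i).2 == Nexp m + j)%N)
     (\prod_u (x.1 u).+1) * \prod_i trinom (x.2 i))%N.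
Proof.
pose P (a : arrays m) : bool := `[< admissible a j >].
have PE : [set a : arrays m | admissible a j]%classic = [set` P]%classic.
  by apply/seteqP; split=> a /asboolP.
pose r := [seq decode x | x <- enum T].
have ur : uniq r by rewrite map_inj_uniq ?enum_uniq //; exact: decode_inj.
rewrite /gamma PE -(bigfs _ ur) => [|a /asboolP /admissible_in_decode [x <-]]; last first.
  by move=> /negP; case; apply: map_f; rewrite mem_enum.
rewrite big_map big_enum_cond /=; apply: eq_big => x; last by rewrite weight_decode.
by apply/asboolP/idP => /admissible_decode.
Qed.

(** [e_a] is the coefficient of [X^(2m - a)], computed by the trinomial expansion; for a negative or
    beyond 2m both sides are zero. *)
Lemma ev_es_trinomial (y : 'I_n -> C) (z : C) (a : int) :
  \prod_(i < n) ('X + (y i)%:P) = ('X^2 + 'X + z%:P) ^+ m ->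
  ev y (es R n a) =
  \sum_(t : triple m | (t.1.1 + t.1.2 + t.2 == m)%N &&
     ((2 * t.1.1 + t.1.2)%:Z == n%:Z - a)) z ^+ t.2 *+ trinom t.
Proof.
move=> hy; rewrite ev_es; case: a => k; last first.
  rewrite big_pred0 // => t; apply/negP => /andP[/eqP h /eqP]; lia.
have [kn|nk] := leqP k n.
  rewrite -coef_prodXD // hy coef_trinomial; apply: eq_bigl => t; congr (_ && _).
  by apply/eqP/eqP; lia.
rewrite -ev_mesym mesym_geqnE // mmap0 big_pred0 // => t.
by apply/negP => /andP[/eqP h /eqP]; lia.
Qed.

(** Distributing the product over i indexes the terms by balanced arrays, with z raised to the sum
    of the [c_i]. [sum_c_ge] and [sum_c_le] confine this sum to the degrees that [Gamma] records. *)
Lemma ev_flow_form (y : 'I_n -> C) (z : C) :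
  \prod_(i < n) ('X + (y i)%:P) = ('X^2 + 'X + z%:P) ^+ m ->
  ev y (flow_form R m) = z ^+ Nexp m * (Gamma C m).[z].
Proof.
move=> hy; pose W x : nat := ((\prod_u (x.1 u).+1) * \prod_i trinom (x.2 i))%N.
pose s x : nat := (\sum_i (x.2 i).2)%N.
have bound x : balanced_all x -> (Nexp m <= s x <= Nexp m + gexp m)%N.
  move=> /forallP h; apply/andP; split.
    by apply: (sum_c_ge (fl := flow_of x.1)) => i; have /andP[/eqP h1 /eqP h2] := h i.
  by apply: (sum_c_le (fl := flow_of x.1)) => i; have /andP[/eqP h1 /eqP h2] := h i.
transitivity (\sum_(x : T | balanced_all x) z ^+ s x *+ W x).
  rewrite /flow_form raddf_sum /=.
  rewrite -(pair_big_dep xpredT (fun f (t : {ffun 'I_m -> triple m}) => balanced_all (f, t))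
      (fun f t => z ^+ s (f, t) *+ W (f, t))) /=.
  apply: eq_bigr => f _; rewrite mmapZ /es_prod [X in _ * X]rmorph_prod /=.
  rewrite [X in _ * X](eq_bigr _ (fun i _ => ev_es_trinomial _ hy)).
  rewrite bigA_distr_big_dep /= mulr_sumr; apply: eq_big => t.
    by rewrite /balanced_all; apply/familyP/forallP.
  move=> _; rewrite /W /s /= -mulr_natl natrM -mulrA; congr (_ * _).
    rewrite /gweight rmorph_prod natr_prod; apply: eq_bigr => u _.
    by rewrite /= rmorph_nat.
  rewrite -prodrXr natr_prod -big_split /=; apply: eq_bigr => i _.
  by rewrite mulr_natl.
rewrite /Gamma horner_poly mulr_sumr.
have hj x : (s x - Nexp m < (gexp m).+1)%N || ~~ balanced_all x.
  by case: (boolP (balanced_all x)) => [/bound|]; rewrite ?orbT // orbF; lia.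
rewrite (partition_big (fun x => inord (s x - Nexp m) : 'I_(gexp m).+1) xpredT) //=.
apply: eq_bigr => j _; rewrite gammaE natr_sum mulr_suml mulr_sumr.
apply: eq_big => x.
  case: (boolP (balanced_all x)) => //= /bound bx.
  rewrite -val_eqE /= inordK; last by lia.
  by rewrite -/(s x); lia.
move=> /andP[bx /eqP <-]; have := bound _ bx => b2.
rewrite inordK; last by lia.
rewrite mulrCA -exprD -/(W x) mulr_natl; congr (_ ^+ _ *+ _); lia.
Qed.

Lemma gamma0_gt0 : (0 < gamma m 0)%N.
Proof.
(* The zero flow with [a_i = max (m - 2i, 0)] and [c_i = max (2i - m, 0)] attains the lower bound of
   [sum_c_ge]. *)
pose f0 : J := [ffun=> ord0].
pose a i : nat := (2 * (m - i.+1) - m)%N.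
pose c i : nat := (2 * i.+1 - m)%N.
have ha (i : 'I_m) : (a i < m.+1)%N by rewrite /a; have := ltn_ord i; lia.
have hc (i : 'I_m) : (c i < m.+1)%N by rewrite /c; have := ltn_ord i; lia.
have hb (i : 'I_m) : (m - a i - c i < m.+1)%N by lia.
pose t0 : {ffun 'I_m -> triple m} :=
  [ffun i => (Ordinal (ha i), Ordinal (hb i), Ordinal (hc i))].
have bal i : balanced f0 i (t0 i).
  rewrite /balanced /t0 ffunE /= exponent0 /a /c; have := ltn_ord i.
  by move=> im; apply/andP; split; apply/eqP; lia.
rewrite gammaE (bigD1 (f0, t0)) /=.
  rewrite addn_gt0; apply/orP; left; rewrite muln_gt0 !prodn_gt0 // => i.
  by apply: trinom_gt0; have /andP[/eqP] := bal i.
apply/andP; split; first by apply/forallP.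
rewrite addn0 -sum_tail_index; apply/eqP; apply: eq_bigr => i _.
by rewrite /t0 ffunE.
Qed.
End GammaLink.

(** * Newton's inequalities *)

Section Newton.
Variable R : rcfType.
Local Notation C := R[i].
Local Notation Im := complex.Im.
Local Notation rc := (real_complex R).

(* [f = 0] is allowed so that the property survives differentiation. *)
Definition half_plane_free (f : {poly C}) := f = 0 \/ forall z, 0 < Im z -> f.[z] != 0.

Lemma half_plane_free_deriv f : half_plane_free f -> half_plane_free f^`().
Proof.
case=> [->|hf]; first by left; rewrite deriv0.
have [sf|sf] := leqP (size f) 1%N; first by left; rewrite (size1_polyC sf) derivC.
by right=> z hz; apply: gauss_lucas => // u zu; apply: hf; apply: lt_le_trans zu.
Qed.

Lemma half_plane_free_derivn k f : half_plane_free f -> half_plane_free f^`(k).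
Proof.
move=> hf; elim: k => [|k IH]; first by rewrite derivn0.
by rewrite derivnS; exact: half_plane_free_deriv.
Qed.

(* [z ^ d * f (- z^-1)]; the sign makes the substitution preserve the upper
   half-plane. *)
Definition inversion (A : nzRingType) d (f : {poly A}) : {poly A} :=
  \poly_(i < d.+1) ((-1) ^+ (d - i) * f`_(d - i)).

Lemma horner_inversion d (f : {poly C}) z : (size f <= d.+1)%N -> z != 0 ->
  (inversion d f).[z] = z ^+ d * f.[- z^-1].
Proof.
move=> sf z0; rewrite horner_poly (horner_coef_wide _ sf) mulr_sumr.
rewrite (reindex_inj rev_ord_inj) /=; apply: eq_bigr => i _.
have id : (i <= d)%N by rewrite -ltnS.
rewrite subSS subKn // [(- z^-1) ^+ _]exprNn exprVn.
rewrite [z ^+ d in RHS](_ : _ = z ^+ (d - i) * z ^+ i); last first.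
  by rewrite -exprD subnK.
have zi : z ^+ i != 0 by rewrite expf_neq0.
by field.
Qed.

Lemma half_plane_free_inversion d (f : {poly C}) : (size f <= d.+1)%N ->
  half_plane_free f -> half_plane_free (inversion d f).
Proof.
move=> sf [->|hf]; [left|right=> z hz].
  by apply/polyP => i; rewrite coef_poly !coef0 mulr0 if_same.
have z0 : z != 0 by apply: contraTneq hz => ->; rewrite ltxx.
rewrite horner_inversion // mulf_neq0 ?expf_neq0 // hf //.
by rewrite ImN oppr_gt0 ImV_lt0.
Qed.

(** A negative discriminant would give a conjugate pair of non-real roots; the absolute value of the
    leading coefficient in the witness selects the one in the upper half-plane. *)
Lemma half_plane_free_quadratic (q : {poly R}) : (size q <= 3)%N ->
  half_plane_free (map_poly rc q) -> 4 * q`_0 * q`_2 <= q`_1 ^+ 2.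
Proof.
move=> sq hq; have [c0|c0] := eqVneq q`_2 0; first by rewrite c0 mulr0 sqr_ge0.
case: hq => [q0|hq].
  by have /= := coef_map rc q 2; rewrite q0 coef0 => -[e2]; rewrite -e2 eqxx in c0.
rewrite leNgt; apply/negP => lt; pose d := Num.sqrt (4 * q`_0 * q`_2 - q`_1 ^+ 2).
have d0 : 0 < d by rewrite sqrtr_gt0 subr_gt0.
have d2 : d ^+ 2 = 4 * q`_0 * q`_2 - q`_1 ^+ 2 by rewrite sqr_sqrtr // subr_ge0 ltW.
pose z : C := Complex (- q`_1 / (2 * q`_2)) (d / (2 * `|q`_2|)).
have /hq /eqP : 0 < Im z by rewrite /= divr_gt0 // mulr_gt0 // normr_gt0.
apply; rewrite (@horner_coef_wide _ 3) ?size_map_poly //.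
rewrite !big_ord_recl big_ord0 /= !coef_map /= addr0 expr0 mulr1 expr1.
have n2 : `|q`_2| ^+ 2 = q`_2 ^+ 2 by rewrite real_normK // num_real.
have nz : `|q`_2| != 0 by rewrite normr_eq0.
rewrite /bump /= expr2 /z; move: d2 n2 nz; move: `|q`_2| => c d2 n2 nz.
apply/eqP; rewrite eq_complex /=; apply/andP; split; apply/eqP;
  rewrite ?mul0r ?mulr0 ?subr0 ?addr0 ?add0r.
  have -> : d / (2 * c) * (d / (2 * c)) = d ^+ 2 / (4 * c ^+ 2) by field.
  by rewrite d2 n2; field.
by field; rewrite nz c0.
Qed.

(* The substitution inverts the roots, so it exchanges the two ends of the
   coefficient sequence; differentiating before and after it isolates three
   consecutive coefficients in a quadratic. *)
Lemma newton_inequality (f : {poly R}) e j : (size f <= e.+1)%N ->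
  half_plane_free (map_poly rc f) -> (1 <= j < e)%N ->
  ((j + 1) * (e - j + 1))%:R / (j * (e - j))%:R * f`_(j - 1) * f`_(j + 1) <= f`_j ^+ 2.
Proof.
case: j => // j sf hf /andP[_ je]; rewrite subn1 addn1 /=.
have [n en] : exists n, e = (j + n).+2 by exists (e - j.+2)%N; lia.
(* Here [j] has already been lowered by one. [f1] has degree at most [n + 2] and its three lowest
   coefficients carry the three in question; inversion makes them the top three, and n derivatives
   bring these to degrees 2, 1, 0. *)
rewrite {je}en in sf *; pose f1 := f^`(j); pose q := (inversion n.+2 f1)^`(n).
have sf1 : (size f1 <= n.+3)%N.
  apply/leq_sizeP => k nk; rewrite coef_derivn nth_default ?mul0rn //.
  by apply: leq_trans sf _; lia.
have mapinv (g : {poly R}) d : map_poly rc (inversion d g) = inversion d (map_poly rc g).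
  apply/polyP => i; rewrite coef_map coef_poly [RHS]coef_poly.
  case: ifP => _; last by rewrite raddf0.
  by rewrite coef_map -[LHS]/(rc _) rmorphM rmorphXn rmorphN1.
have sq : (size q <= 3)%N.
  apply/leq_sizeP => k nk; rewrite coef_derivn coef_poly ltnNge.
  by rewrite (_ : (n.+2 < n + k)%N) ?mul0rn //; lia.
have hq : half_plane_free (map_poly rc q).
  rewrite -derivn_map mapinv -derivn_map; apply: half_plane_free_derivn.
  apply: half_plane_free_inversion; last exact: half_plane_free_derivn.
  by rewrite derivn_map size_map_poly.
have := half_plane_free_quadratic sq hq.
have ffE (x : R) a b : x *+ (a + b) ^_ a = x * ((a + b)`!%:R / b`!%:R).
  rewrite -[LHS]mulr_natr; congr (_ * _).
  have := ffact_fact (leq_addr b a); rewrite addKn => <-.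
  by rewrite natrM mulfK // pnatr_eq0 -lt0n fact_gt0.
have fn k : k`!%:R != 0 :> R by rewrite pnatr_eq0 -lt0n fact_gt0.
have subE a : (n.+2 - (n + a) = 2 - a)%N by lia.
rewrite /q !coef_derivn !coef_poly !coef_derivn !subE !subn0 subnn (_ : (2 - 1 = 1)%N) //.
have ltE a : (a < 3)%N -> (n + a < n.+3)%N by lia.
rewrite !ltE //.
rewrite !(ffE _ n 0, ffE _ n 1, ffE _ n 2, ffE _ j 0, ffE _ j 1, ffE _ j 2).
have -> : ((j + n).+2 - j.+1 = n.+1)%N by lia.
rewrite !addn0 !addn1 !addn2 !factS !fact0 !natrM expr1 expr0 sqrrN expr1n !mul1r.
have := fn j; have := fn n; move: (j`!%:R) (n`!%:R) => J N N0 J0 h.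
have r0 : n.+1%:R != 0 :> R by rewrite pnatr_eq0.
have p0 : j.+1%:R != 0 :> R by rewrite pnatr_eq0.
have K0 : 0 < (J * N * (j.+1%:R * n.+1%:R)) ^+ 2 by rewrite exprn_even_gt0 //= !mulf_neq0.
rewrite -(ler_pM2r K0); apply: le_trans (le_trans h _);
  rewrite le_eqVlt; apply/orP; left; apply/eqP.
  by field; rewrite !nat1r r0 p0.
by field.
Qed.


End Newton.

(** * Roots of the gamma polynomial *)

Section GammaRoots.
Variables (R : realType) (m : nat).
Local Notation n := (2 * m)%N.
Local Notation C := R[i].
Local Notation Im := complex.Im.
Local Notation Re := complex.Re.
Local Notation ev y := (mmap (real_complex R) y).

Lemma ev_flow_form_homog (y : 'I_n -> C) (u : C) :
  ev (fun i => u * y i) (flow_form R m) = u ^+ (m * m.+1) * ev y (flow_form R m).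
Proof.
rewrite /flow_form !raddf_sum /= mulr_sumr; apply: eq_bigr => f _.
rewrite !mmapZ mulrCA; congr (_ * _); set fl := flow_of f.
have [/existsP h|/existsPn pos] := boolP [exists i, exponent fl i < 0].
  by rewrite es_prod0 // !mmap0 mulr0.
have -> : (m * m.+1)%N = (\sum_i absz (exponent fl i))%N.
  suff : (\sum_i absz (exponent fl i))%N%:Z = (m * m.+1)%:Z by case.
  rewrite -(sum_exponent1 fl) -[LHS]natz natr_sum; apply: eq_bigr => i _.
  by rewrite natz; have := pos i; lia.
rewrite /es_prod !rmorph_prod -prodrXr -big_split /=; apply: eq_bigr => i _.
rewrite !ev_es; case: (exponent fl i) (pos i) => // k _.
rewrite /esum mulr_sumr; apply: eq_bigr => h /eqP <-.
by rewrite big_split prodr_const.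
Qed.

Lemma complex_sqrt (z : C) : exists2 s : C, s ^+ 2 = z & 0 <= Re s.
Proof.
have e := sqr_sqrtc z; case: (leP 0 (Re (sqrtc z))) => h; first by exists (sqrtc z).
by exists (- sqrtc z); [rewrite sqrrN | rewrite raddfN oppr_ge0 ltW].
Qed.

Lemma Gamma_root_neg (z : C) : root (Gamma C m) z -> Im z = 0 /\ Re z < 0.
Proof.
move=> /rootP rz.
have z0 : z != 0.
  apply: contra_eq_neq rz => ->; rewrite horner_coef0 coef_poly /=.
  by rewrite pnatr_eq0 -lt0n gamma0_gt0.
have [d d2 _] := complex_sqrt (1 - 4 * z).
pose a := (1 + d) / 2; pose b := (1 - d) / 2.
have ab1 : a + b = 1 by rewrite /a /b; field.
have abz : a * b = z.
  by rewrite /a /b mulf_div [(1 + d) * _]mulrC -subr_sqr d2 expr1n; field.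
have [a0 b0] : a != 0 /\ b != 0 by split; apply: contraNneq z0 => h; rewrite -abz h ?mulr0 ?mul0r.
pose y (i : 'I_n) := if (i < m)%N then a else b.
have hy : \prod_(i < n) ('X + (y i)%:P) = ('X^2 + 'X + z%:P) ^+ m.
  rewrite -(big_mkord xpredT (fun i => 'X + (if (i < m)%N then a else b)%:P)).
  rewrite mul2n -addnn (@big_cat_nat _ _ _ m) //= ?leq_addr //.
  rewrite (eq_big_nat _ _ (F2 := fun=> 'X + a%:P)) => [|i /andP[_ ->]] //.
  rewrite [X in _ * X](eq_big_nat _ _ (F2 := fun=> 'X + b%:P)) => [|i /andP[+ _]]; last first.
    by rewrite leqNgt => /negbTE ->.
  rewrite !big_const_nat !iter_mulr_1 subn0 addnK -exprMn; congr (_ ^+ _).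
  rewrite mulrDl !mulrDr -polyCM abz -expr2 !addrA; congr (_ + _).
  by rewrite -addrA [a%:P * _]mulrC -mulrDr -polyCD [b + a]addrC ab1 mulr1.
have ev0 : ev y (flow_form R m) = 0 by rewrite (ev_flow_form hy) rz mulr0.
have [s s2 s_ge0] := complex_sqrt (a / b).
have s0 : s != 0 by apply: contra_eq_neq s2 => ->; rewrite expr0n /= eq_sym mulf_neq0 ?invr_eq0.
have hs : Re s = 0.
  apply: contra_eq ev0 => hs; have {}s_ge0 : 0 < Re s by rewrite lt_def hs.
  (* As [s^2 = a / b], this factor sends a to [i s] and b to [- (i s)^-1]; both have positive
     imaginary part as soon as [Re s > 0]. *)
  have := @flow_form_stable R m (fun i => 'i%C / (b * s) * y i).
  rewrite ev_flow_form_homog => H; apply: contraTneq isT => ev0.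
  have : upper (fun i : 'I_n => 'i%C / (b * s) * y i).
    have is_gt0 : 0 < Im ('i%C * s).
      by case: (s) s_ge0 => x t /=; rewrite mul0r mul1r add0r.
    move=> i; rewrite /y; case: ifP => _.
      have -> // : 'i%C / (b * s) * a = 'i%C * s.
      by rewrite -[a](divfK b0) -s2; field; rewrite ?b0 ?s0.
    have -> : 'i%C / (b * s) * b = - ('i%C * s)^-1.
      have iV : ('i%C)^-1 = - 'i%C :> C.
        by apply/eqP; rewrite eq_complex /= expr0n expr1n add0r !divr1 oppr0 !eqxx.
      by rewrite [('i%C * s)^-1]invfM iV; field; rewrite ?b0 ?s0.
    by rewrite ImN oppr_gt0 ImV_lt0.
  by move=> /H; rewrite ev0 mulr0 eqxx.
pose t := Im s; have st : s = Complex 0 t by rewrite /t -hs; case: (s).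
have r2 : a = (- t ^+ 2)%:C%C * b.
  rewrite -[LHS](divfK b0) -s2 st; congr (_ * _).
  by apply/eqP; rewrite eq_complex /= !(mul0r, mulr0, addr0, subr0, sub0r, add0r) -expr2 !eqxx.
have t2 : 1 - t ^+ 2 != 0.
  apply: contra_eq_neq ab1 => t1; rewrite r2 -[X in _ + X]mul1r -mulrDl.
  by rewrite -[X in _ + X]/(1%:C%C) -rmorphD addrC t1 mul0r eq_sym oner_eq0.
have bE : b = ((1 - t ^+ 2)^-1)%:C%C.
  rewrite fmorphV -[RHS]mul1r; apply: (canRL (mulfK _)); first by rewrite fmorph_eq0.
  by rewrite rmorphB rmorph1 mulrBr mulr1 -ab1 r2 rmorphN; ring.
(* Thus [z = - (t / (1 - t^2))^2] with t nonzero. *)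
rewrite -abz r2 bE -!rmorphM /=; split => //.
rewrite mulNr mulNr oppr_lt0 -mulrA -expr2 -exprMn exprn_even_gt0 //= mulf_neq0 ?invr_eq0 //.
by apply: contraTneq s0 => t0; rewrite st t0 eqxx.
Qed.
End GammaRoots.

Theorem corollary6p2 (R : realType) (m : nat) (hm : (1 <= m)%N) :
  (forall z : R[i], root (Gamma R[i] m) z ->
     complex.Im z = 0 /\ complex.Re z < 0) /\
  ((2 <= gexp m)%N ->
   forall j : nat, (1 <= j < gexp m)%N ->
     (gamma m j)%:R ^+ 2 >=
       ((j + 1) * (gexp m - j + 1))%:R / (j * (gexp m - j))%:R *
       (gamma m (j - 1))%:R * (gamma m (j + 1))%:R :> R).
Proof.
split=> [z /Gamma_root_neg //|_ j hj].
have mapG : map_poly (real_complex R) (Gamma R m) = Gamma R[i] m.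
  apply/polyP => k; rewrite coef_map !coef_poly; case: ifP => _ /=; last by rewrite raddf0.
  by rewrite rmorph_nat.
have free : half_plane_free (map_poly (real_complex R) (Gamma R m)).
  right=> z z0; rewrite mapG; apply/negP => /Gamma_root_neg [zi _].
  by rewrite zi ltxx in z0.
have := newton_inequality (size_poly _ _) free hj.
have [j1 j2 j3] : [/\ j - 1 < (gexp m).+1, j < (gexp m).+1 & j + 1 < (gexp m).+1]%N.
  by case/andP: hj => *; split; lia.
by rewrite !coef_poly j1 j2 j3.
Qed.
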